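(* Let $0<\alpha<1$. Then the Ces\`aro operator $\mathcal{C}$ is bounded on $H^\infty_{\alpha,\log}$, its norm satisfies $$\|\mathcal{C}\|_{H^\infty_{\alpha,\log}\to H^\infty_{\alpha,\log}}=\sup_{0\le r<1}\int_0^\infty\frac{(1+r)^\alpha e^{-t}\big(1-(1-e^{-t})r\big)^{2\alpha-1}\log\dfrac{2e^{1/\alpha}}{1-r^2}}{\big(1-(1-2e^{-t})r\big)^\alpha\log\dfrac{2e^{1/\alpha}}{1-\left(\frac{e^{-t}r}{1-(1-e^{-t})r}\right)^2}}\,dt,$$ and $$\|\mathcal{C}\|_{H^\infty_{\alpha,\log}\to H^\infty_{\alpha,\log}}\ge\frac1\alpha.$$
   Context: $\mathbb{D}$ is the open unit disc and $H(\mathbb{D})$ the space of analytic functions on $\mathbb{D}$. For $f(z)=\sum_{k\ge0}a_kz^k\in H(\mathbb{D})$ the Ces\`aro operator is $\mathcal{C}(f)(z)=\sum_{n\ge0}\Big(\frac{1}{n+1}\sum_{k=0}^n a_k\Big)z^n=\int_0^1\frac{f(tz)}{1-tz}\,dt$. For $0<\alpha<1$, the logarithmically weighted Korenblum space $H^\infty_{\alpha,\log}$ consists of $f\in H(\mathbb{D})$ with $\|f\|_{H^\infty_{\alpha,\log}}=\sup_{z\in\mathbb{D}}(1-|z|^2)^\alpha\log\frac{2e^{1/\alpha}}{1-|z|^2}\,|f(z)|<\infty$. Operator norms are $\|\mathcal{C}\|_{X\to Y}=\sup\{\|\mathcal{C}f\|_Y:\|f\|_X\le 1\}$. *)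

(* Defs.v *)
From Stdlib Require Import Reals.
From Coquelicot Require Import Coquelicot.
Open Scope R_scope.

(* An analytic function f on the unit disc is
   represented by its Taylor coefficient sequence a : nat -> C, required to
   give a power series converging at every point of the open unit disc. *)

Definition in_disc (z : C) : Prop := Cmod z < 1.

Definition analytic_disc (a : nat -> C) : Prop :=
  forall z : C, in_disc z -> ex_series (fun k => Cmult (a k) (pow_n z k)).

Definition psum (a : nat -> C) (z : C) : C :=
  (Series (fun k => Re (Cmult (a k) (pow_n z k))),
   Series (fun k => Im (Cmult (a k) (pow_n z k)))).

Definition cesaro (a : nat -> C) : nat -> C :=
  fun n => Cmult (RtoC (/ INR (S n))) (sum_n a n).

Definition kweight (alpha : R) (z : C) : R :=
  Rpower (1 - Cmod z ^ 2) alpha * ln (2 * exp (/ alpha) / (1 - Cmod z ^ 2)).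

Definition hnorm (alpha : R) (a : nat -> C) : Rbar :=
  Lub_Rbar (fun x => exists z : C, in_disc z /\ x = kweight alpha z * Cmod (psum a z)).

Definition in_Hlog (alpha : R) (a : nat -> C) : Prop :=
  analytic_disc a /\ is_finite (hnorm alpha a).

Definition cesaro_opnorm (alpha : R) : Rbar :=
  Rbar_lub (fun x => exists a, in_Hlog alpha a /\ Rbar_le (hnorm alpha a) 1 /\
                               x = hnorm alpha (cesaro a)).

Definition norm_integrand (alpha r t : R) : R :=
  (Rpower (1 + r) alpha * exp (- t) * Rpower (1 - (1 - exp (- t)) * r) (2 * alpha - 1)
     * ln (2 * exp (/ alpha) / (1 - r ^ 2)))
  / (Rpower (1 - (1 - 2 * exp (- t)) * r) alpha
     * ln (2 * exp (/ alpha) /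
           (1 - (exp (- t) * r / (1 - (1 - exp (- t)) * r)) ^ 2))).

Definition norm_integral (alpha r : R) : R :=
  RInt_gen (norm_integrand alpha r) (at_point 0) (Rbar_locally p_infty).

Definition norm_formula (alpha : R) : Rbar :=
  Lub_Rbar (fun x => exists r, 0 <= r < 1 /\ x = norm_integral alpha r).

(* Main.v *)
Require Import Defs.
From Stdlib Require Import Reals Lra Lia.
From Coquelicot Require Import Coquelicot.
Open Scope R_scope.

(** With [D_u = 1 - (1-u) z] and [phi_u = u z / D_u] one has
    [C f (z) = int_0^1 f (phi_u) / D_u du], and both [|phi_u|] and [1 / |D_u|] are largest at
    [z = |z| = r]. As the weight [v] is radially decreasing, [v (r) |C f (z)|] is at most
    [||f||] times [int_0^1 v (r) / (v (phi_u (r)) D_u (r)) du], which is the integral of the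
    theorem after [u = e^-t]. Equality of the suprema holds because [1 / v (r)] is the
    restriction to [0, 1) of [f (z) = 1 / ((1 - z^2)^alpha log (2 e^(1/alpha) / (1 - z^2)))],
    whose Taylor coefficients are nonnegative, so that [|f (z)| <= f (|z|)] and [f] has norm one.
    The kernel lies between [((1+r)/2) D_u^(alpha-1)], whose integral tends to [1/alpha] as
    [r] tends to [1], and a multiple of [u^(alpha/2-1)] independent of [r]. *)

(** A function on the disc is available only as two real series, so no complex integral is ever
    formed. The integral representation is C f (z) = (1/z) int_0^z f (w) / (1 - w) dw along the path
    w = phi_u (z), for which 1 - phi_u = (1 - z) / D_u and d phi_u / (1 - phi_u) = z du / D_u. It
    enters only as an upper estimate of Re (theta C f (z)) with a free factor theta: the conjugate
    of C f (z) gives the bound for |C f (z)|, and theta = -1 at a real point gives the reverse bound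
    for the extremal function.

    The constant e^(1/alpha) acts twice. It makes alpha times the logarithm at least 1, from which
    the weight decreases; and as a power series in x = z^2 the logarithm has constant term c = log 2
    + 1/alpha with alpha c >= 1, from which the coefficients of (1 - x)^(-alpha) / (c - log (1 - x))
    are nonnegative.

    The exponent alpha/2 of the upper bound for the kernel arises because half of alpha is given up
    to absorb the quotient of the two logarithms. *)

(** * Power series on the disc: coefficient bounds and geometric tails *)

Lemma Cmod_pow_n (z : C) (n : nat) : Cmod (pow_n z n) = Cmod z ^ n.
Proof.
  induction n as [|n IH]; simpl; [exact Cmod_1|].
  change (Cmod (Cmult z (pow_n z n)) = Cmod z * Cmod z ^ n).
  now rewrite Cmod_mult, IH.
Qed.

Lemma Re_sum_n (f : nat -> C) (n : nat) : Re (sum_n f n) = sum_n (fun k => Re (f k)) n.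
Proof.
  induction n as [|n IH]; [now rewrite !sum_O|].
  rewrite !sum_Sn, <- IH; reflexivity.
Qed.

Lemma Im_sum_n (f : nat -> C) (n : nat) : Im (sum_n f n) = sum_n (fun k => Im (f k)) n.
Proof.
  induction n as [|n IH]; [now rewrite !sum_O|].
  rewrite !sum_Sn, <- IH; reflexivity.
Qed.

Lemma Rabs_Im_le_Cmod (z : C) : Rabs (Im z) <= Cmod z.
Proof.
  rewrite <- sqrt_Rsqr_abs; unfold Cmod; apply sqrt_le_1_alt.
  unfold Rsqr, Im; simpl; nra.
Qed.

Lemma Cmod_le_Re_Im (z : C) : Cmod z <= Rabs (Re z) + Rabs (Im z).
Proof.
  unfold Cmod.
  rewrite <- (sqrt_Rsqr (Rabs (Re z) + Rabs (Im z))).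
  - apply sqrt_le_1_alt; unfold Rsqr, Re, Im.
    pose proof (Rabs_pos (fst z)); pose proof (Rabs_pos (snd z)).
    rewrite <- (pow2_abs (fst z)), <- (pow2_abs (snd z)); nra.
  - pose proof (Rabs_pos (Re z)); pose proof (Rabs_pos (Im z)); lra.
Qed.

(** A Cauchy estimate. Having one for every rho < 1 is equivalent to analyticity on the disc, and it
    makes all tails geometric with explicit constants. *)
Definition coef_bound (a : nat -> C) (rho M : R) : Prop :=
  forall n, Cmod (a n) * rho ^ n <= M.

Lemma analytic_disc_coef_bound (a : nat -> C) (rho : R) :
  analytic_disc a -> 0 < rho < 1 -> exists M, 0 <= M /\ coef_bound a rho M.
Proof.
  intros Han Hr.
  assert (Hz : in_disc (RtoC rho)).
  { unfold in_disc; rewrite Cmod_R, Rabs_pos_eq; lra. }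
  (* The Cauchy criterion with bound 1, applied to blocks of a single term, controls all terms from
     index [N] on; the finitely many earlier ones are bounded by their sum. *)
  destruct (Cauchy_ex_series _ (Han _ Hz) (mkposreal 1 Rlt_0_1)) as [N HN].
  set (t := fun n => Cmod (a n) * rho ^ n).
  assert (Ht : forall n, 0 <= t n).
  { intro n; apply Rmult_le_pos; [apply Cmod_ge_0|apply pow_le; lra]. }
  assert (Hs : forall n, 0 <= sum_n t n).
  { induction n; [now rewrite sum_O|rewrite sum_Sn].
    unfold plus; simpl; specialize (Ht (S n)); lra. }
  assert (Hb : forall m n, (n <= m)%nat -> t n <= sum_n t m).
  { induction m; intros n Hn.
    - replace n with 0%nat by lia; rewrite sum_O; lra.
    - rewrite sum_Sn; unfold plus; simpl.
      destruct (Nat.eq_dec n (S m)) as [->|Hne].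
      + specialize (Hs m); lra.
      + specialize (IHm n ltac:(lia)); specialize (Ht (S m)); lra. }
  exists (sum_n t N + 1); split; [specialize (Hs N); lra|].
  intro n; destruct (Compare_dec.le_dec n N) as [Hn|Hn].
  - specialize (Hb N n Hn); unfold t in *; lra.
  - specialize (HN n n ltac:(lia) ltac:(lia)); rewrite sum_n_n in HN.
    change (Cmod (Cmult (a n) (pow_n (RtoC rho) n)) < 1) in HN.
    rewrite Cmod_mult, Cmod_pow_n, Cmod_R, Rabs_pos_eq in HN by lra.
    specialize (Hs N); unfold t in *; lra.
Qed.

Lemma coef_bound_term (a : nat -> C) (rho M q : R) (z : C) (n : nat) :
  coef_bound a rho M -> 0 < rho -> 0 <= q -> Cmod z <= q * rho ->
  Cmod (Cmult (a n) (pow_n z n)) <= M * q ^ n.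
Proof.
  intros Hb Hr Hq Hz.
  rewrite Cmod_mult, Cmod_pow_n.
  apply Rle_trans with (Cmod (a n) * rho ^ n * q ^ n).
  - rewrite Rmult_assoc, <- Rpow_mult_distr, (Rmult_comm rho).
    apply Rmult_le_compat_l; [apply Cmod_ge_0|].
    apply pow_incr; split; [apply Cmod_ge_0|exact Hz].
  - apply Rmult_le_compat_r; [now apply pow_le|apply Hb].
Qed.

Lemma ex_series_scal_geom (M q : R) : 0 <= q < 1 -> ex_series (fun n => M * q ^ n).
Proof.
  intro Hq; apply (ex_series_scal_l M (fun n => q ^ n)), ex_series_geom.
  rewrite Rabs_pos_eq; lra.
Qed.

Lemma analytic_disc_of_coef_bound (a : nat -> C) :
  (forall rho, 0 < rho < 1 -> exists M, coef_bound a rho M) -> analytic_disc a.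
Proof.
  intros H z Hz; unfold in_disc in Hz; pose proof (Cmod_ge_0 z).
  set (rho := (Cmod z + 1) / 2).
  assert (Hr : 0 < rho < 1) by (unfold rho; lra).
  destruct (H rho Hr) as [M HM].
  assert (Hq : 0 <= Cmod z / rho < 1).
  { split; [apply Rdiv_le_0_compat; lra|].
    apply (Rdiv_lt_1 (Cmod z) rho); unfold rho in *; lra. }
  apply (@ex_series_le C_AbsRing C_CompleteNormedModule _ (fun n => M * (Cmod z / rho) ^ n)).
  - intro n; apply (coef_bound_term a rho); try lra; [assumption|].
    right; field; lra.
  - now apply ex_series_scal_geom.
Qed.

Lemma Series_geom_tail (f : nat -> R) (M q : R) (N : nat) :
  0 <= q < 1 -> (forall n, Rabs (f n) <= M * q ^ n) ->
  Rabs (Series f - sum_n f N) <= M * q ^ S N / (1 - q).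
Proof.
  intros Hq Hf.
  assert (He : ex_series f).
  { apply (@ex_series_le R_AbsRing R_CompleteNormedModule f (fun n => M * q ^ n)); [exact Hf|].
    now apply ex_series_scal_geom. }
  rewrite (Series_incr_n f (S N)) by (auto with arith); simpl pred.
  rewrite sum_n_Reals.
  replace (sum_f_R0 f N + Series (fun k => f (S N + k)%nat) - sum_f_R0 f N)
    with (Series (fun k => f (S N + k)%nat)) by ring.
  assert (Hg : forall n, 0 <= Rabs (f (S N + n)%nat) <= M * q ^ S N * q ^ n).
  { intro n; split; [apply Rabs_pos|].
    rewrite Rmult_assoc, <- pow_add; apply Hf. }
  assert (Hge : ex_series (fun n => M * q ^ S N * q ^ n)) by now apply ex_series_scal_geom.
  eapply Rle_trans; [apply Series_Rabs|].
  - apply (@ex_series_le R_AbsRing R_CompleteNormedModule _ (fun n => M * q ^ S N * q ^ n));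
      [|exact Hge].
    intro n.
    change (Rabs (Rabs (f (S N + n)%nat)) <= M * q ^ S N * q ^ n).
    rewrite Rabs_Rabsolu; apply Hg.
  - eapply Rle_trans; [apply (Series_le _ _ Hg Hge)|].
    rewrite Series_scal_l, Series_geom by (rewrite Rabs_pos_eq; lra).
    right; reflexivity.
Qed.

(** The factor 2 comes from estimating the real and the imaginary tail separately, as [psum] is a
    pair of real series. *)
Lemma psum_tail (a : nat -> C) (rho M q : R) (z : C) (N : nat) :
  coef_bound a rho M -> 0 < rho -> 0 <= q < 1 -> Cmod z <= q * rho ->
  Cmod (Cminus (psum a z) (sum_n (fun k => Cmult (a k) (pow_n z k)) N))
    <= 2 * (M * q ^ S N / (1 - q)).
Proof.
  intros Hb Hr Hq Hz.
  set (t := fun k => Cmult (a k) (pow_n z k)).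
  assert (Ht : forall n, Cmod (t n) <= M * q ^ n).
  { intro n; apply (coef_bound_term a rho); lra || assumption. }
  eapply Rle_trans; [apply Cmod_le_Re_Im|].
  replace (Re (Cminus (psum a z) (sum_n t N)))
    with (Series (fun k => Re (t k)) - sum_n (fun k => Re (t k)) N)
    by (rewrite <- Re_sum_n; reflexivity).
  replace (Im (Cminus (psum a z) (sum_n t N)))
    with (Series (fun k => Im (t k)) - sum_n (fun k => Im (t k)) N)
    by (rewrite <- Im_sum_n; reflexivity).
  assert (H1 := Series_geom_tail (fun k => Re (t k)) M q N Hq
    (fun n => Rle_trans _ _ _ (re_le_Cmod _) (Ht n))).
  assert (H2 := Series_geom_tail (fun k => Im (t k)) M q N Hq
    (fun n => Rle_trans _ _ _ (Rabs_Im_le_Cmod _) (Ht n))).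
  lra.
Qed.

(** As rho < 1, rho^N <= rho^k for k <= N, so each of the N + 1 summands contributes at most M. *)
Lemma Cmod_sum_n_coef_bound (a : nat -> C) (rho M : R) (N : nat) :
  coef_bound a rho M -> 0 < rho < 1 -> Cmod (sum_n a N) * rho ^ N <= INR (S N) * M.
Proof.
  intros Hb Hr; induction N as [|N IH].
  - rewrite sum_O; specialize (Hb 0%nat); simpl in *; lra.
  - rewrite sum_Sn, (S_INR (S N)).
    assert (H := Cmod_triangle (sum_n a N) (a (S N))).
    assert (Hp : 0 < rho ^ N) by (apply pow_lt; lra).
    change (plus (sum_n a N) (a (S N))) with (Cplus (sum_n a N) (a (S N))).
    apply Rle_trans with ((Cmod (sum_n a N) + Cmod (a (S N))) * rho ^ S N).
    { apply Rmult_le_compat_r; [apply pow_le; lra|exact H]. }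
    specialize (Hb (S N)).
    assert (Cmod (sum_n a N) * rho ^ S N <= Cmod (sum_n a N) * rho ^ N).
    { apply Rmult_le_compat_l; [apply Cmod_ge_0|simpl; nra]. }
    lra.
Qed.

(** The number of summands cancels against the 1 / (n + 1) of the mean, so the constant M survives
    unchanged. *)
Lemma cesaro_coef_bound (a : nat -> C) (rho M : R) :
  coef_bound a rho M -> 0 < rho < 1 -> coef_bound (cesaro a) rho M.
Proof.
  intros Hb Hr n; unfold cesaro.
  assert (Hn : 0 < INR (S n)) by (apply lt_0_INR; lia).
  rewrite Cmod_mult, Cmod_R, Rabs_pos_eq by (left; now apply Rinv_0_lt_compat).
  rewrite Rmult_assoc; apply Rmult_le_reg_l with (INR (S n)); [exact Hn|].
  rewrite <- Rmult_assoc, Rinv_r, Rmult_1_l by lra.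
  now apply Cmod_sum_n_coef_bound.
Qed.

Lemma cesaro_analytic_disc (a : nat -> C) : analytic_disc a -> analytic_disc (cesaro a).
Proof.
  intro Ha; apply analytic_disc_of_coef_bound; intros rho Hr.
  destruct (analytic_disc_coef_bound a rho Ha Hr) as [M [_ HM]].
  exists M; now apply cesaro_coef_bound.
Qed.

(** * Differentiation of complex-valued functions of a real variable *)

(** Componentwise, so that the real fundamental theorem of calculus applies directly to real
    parts. *)
Definition is_Cderive (f : R -> C) (u : R) (l : C) : Prop :=
  is_derive (fun x => Re (f x)) u (Re l) /\ is_derive (fun x => Im (f x)) u (Im l).

Lemma is_Cderive_const (c : C) (u : R) : is_Cderive (fun _ => c) u (RtoC 0).
Proof.
  split; [exact (is_derive_const (Re c) u)|exact (is_derive_const (Im c) u)].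
Qed.

Lemma is_Cderive_RtoC (u : R) : is_Cderive RtoC u (RtoC 1).
Proof.
  split; [exact (is_derive_id u)|exact (is_derive_const 0 u)].
Qed.

Lemma is_Cderive_plus (f g : R -> C) (u : R) (lf lg : C) :
  is_Cderive f u lf -> is_Cderive g u lg ->
  is_Cderive (fun x => Cplus (f x) (g x)) u (Cplus lf lg).
Proof.
  intros [F1 F2] [G1 G2]; split.
  - exact (is_derive_plus _ _ _ _ _ F1 G1).
  - exact (is_derive_plus _ _ _ _ _ F2 G2).
Qed.

Lemma is_derive_Rmult (f g : R -> R) (u lf lg : R) :
  is_derive f u lf -> is_derive g u lg ->
  is_derive (fun x => f x * g x) u (lf * g u + f u * lg).
Proof. intros F G; exact (is_derive_mult f g u lf lg F G Rmult_comm). Qed.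

Lemma is_Cderive_mult (f g : R -> C) (u : R) (lf lg : C) :
  is_Cderive f u lf -> is_Cderive g u lg ->
  is_Cderive (fun x => Cmult (f x) (g x)) u (Cplus (Cmult lf (g u)) (Cmult (f u) lg)).
Proof.
  intros [F1 F2] [G1 G2]; split.
  - replace (Re (Cplus (Cmult lf (g u)) (Cmult (f u) lg)))
      with (minus (Re lf * Re (g u) + Re (f u) * Re lg)
                  (Im lf * Im (g u) + Im (f u) * Im lg))
      by (unfold minus, plus, opp, Re, Im; simpl; ring).
    exact (is_derive_minus _ _ _ _ _ (is_derive_Rmult _ _ _ _ _ F1 G1)
             (is_derive_Rmult _ _ _ _ _ F2 G2)).
  - replace (Im (Cplus (Cmult lf (g u)) (Cmult (f u) lg)))
      with (plus (Re lf * Im (g u) + Re (f u) * Im lg)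
                 (Im lf * Re (g u) + Im (f u) * Re lg))
      by (unfold plus, Re, Im; simpl; ring).
    exact (is_derive_plus _ _ _ _ _ (is_derive_Rmult _ _ _ _ _ F1 G2)
             (is_derive_Rmult _ _ _ _ _ F2 G1)).
Qed.

Lemma is_Cderive_scal (c : C) (f : R -> C) (u : R) (l : C) :
  is_Cderive f u l -> is_Cderive (fun x => Cmult c (f x)) u (Cmult c l).
Proof.
  intro F.
  replace (Cmult c l) with (Cplus (Cmult (RtoC 0) (f u)) (Cmult c l)) by ring.
  exact (is_Cderive_mult (fun _ => c) f u _ _ (is_Cderive_const c u) F).
Qed.

Lemma Cnorm2_neq_0 (z : C) : z <> RtoC 0 -> Re z ^ 2 + Im z ^ 2 <> 0.
Proof.
  intros Hz H; apply Hz; destruct z as [x y]; unfold Re, Im in H; simpl in H.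
  assert (x = 0) by nra; assert (y = 0) by nra; subst; reflexivity.
Qed.

Lemma is_Cderive_inv (f : R -> C) (u : R) (l : C) :
  f u <> RtoC 0 -> is_Cderive f u l ->
  is_Cderive (fun x => Cinv (f x)) u (Copp (Cdiv l (Cmult (f u) (f u)))).
Proof.
  intros Hn [F1 F2].
  assert (Hn2 := Cnorm2_neq_0 _ Hn).
  assert (HN : is_derive (fun x => Re (f x) ^ 2 + Im (f x) ^ 2) u
                 (2 * Re (f u) * Re l + 2 * Im (f u) * Im l)).
  { replace (2 * Re (f u) * Re l + 2 * Im (f u) * Im l)
      with (plus (Re l * Re (f u) + Re (f u) * Re l) (Im l * Im (f u) + Im (f u) * Im l))
      by (unfold plus; simpl; ring).
    eapply is_derive_ext;
      [|exact (is_derive_plus _ _ _ _ _ (is_derive_Rmult _ _ _ _ _ F1 F1)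
                 (is_derive_Rmult _ _ _ _ _ F2 F2))].
    intro t; unfold plus; simpl; ring. }
  (* After expansion [field] meets |f^2|^2 in the form (c^2 - d^2)^2 + (2 c d)^2, which equals (c^2
     + d^2)^2. *)
  assert (Hm : forall c d : R, c ^ 2 + d ^ 2 <> 0 ->
    (c * c - d * d) * (c * c - d * d) + (c * d + d * c) * (c * d + d * c) <> 0).
  { intros c d H; replace (_ + _) with ((c ^ 2 + d ^ 2) ^ 2) by ring; now apply pow_nonzero. }
  split.
  - eapply is_derive_ext; [intro t; reflexivity|].
    evar_last; [exact (is_derive_div _ _ _ _ _ F1 HN Hn2)|].
    clear F1 F2 HN Hn; cbv beta.
    revert Hn2; generalize (f u); intro w; destruct w as [c d], l as [x y]; unfold Re, Im; simpl fst; simpl snd; intro Hn2.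
    unfold Cdiv, Copp, Cinv, Cmult; simpl fst; simpl snd.
    specialize (Hm c d Hn2); field; split;
      intro E; first [apply Hn2; rewrite <- E; ring|apply Hm; rewrite <- E; ring].
  - assert (F3 := is_derive_opp _ _ _ F2).
    eapply is_derive_ext; [intro t; reflexivity|].
    evar_last; [exact (is_derive_div _ _ _ _ _ F3 HN Hn2)|].
    clear F1 F2 F3 HN Hn; cbv beta.
    revert Hn2; generalize (f u); intro w; destruct w as [c d], l as [x y]; unfold Re, Im, opp; simpl fst; simpl snd; simpl; intro Hn2.
    unfold Cdiv, Copp, Cinv, Cmult; simpl fst; simpl snd.
    specialize (Hm c d Hn2); field; split;
      intro E; first [apply Hn2; rewrite <- E; ring|apply Hm; rewrite <- E; ring].
Qed.

Lemma is_Cderive_pow_n (f : R -> C) (u : R) (l : C) (n : nat) :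
  is_Cderive f u l ->
  is_Cderive (fun x => pow_n (f x) (S n)) u
    (Cmult (Cmult (RtoC (INR (S n))) (pow_n (f u) n)) l).
Proof.
  intro F; induction n as [|n IH].
  - simpl pow_n. replace (Cmult _ l) with (Cplus (Cmult l (RtoC 1)) (Cmult (f u) (RtoC 0))).
    + exact (is_Cderive_mult f (fun _ => RtoC 1) u _ _ F (is_Cderive_const _ _)).
    + change (@one C_Ring) with (RtoC 1); simpl INR; ring.
  - replace (Cmult (Cmult _ _) l)
      with (Cplus (Cmult l (pow_n (f u) (S n)))
             (Cmult (f u) (Cmult (Cmult (RtoC (INR (S n))) (pow_n (f u) n)) l))).
    + exact (is_Cderive_mult f (fun x => pow_n (f x) (S n)) u _ _ F IH).
    + rewrite (S_INR (S n)), RtoC_plus.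
      change (pow_n (f u) (S n)) with (Cmult (f u) (pow_n (f u) n)); ring.
Qed.

Lemma is_Cderive_sum_n (f : nat -> R -> C) (u : R) (l : nat -> C) (N : nat) :
  (forall n, is_Cderive (f n) u (l n)) ->
  is_Cderive (fun x => sum_n (fun n => f n x) N) u (sum_n l N).
Proof.
  intro F; induction N as [|N IH].
  - rewrite sum_O; destruct (F 0%nat) as [F1 F2]; split;
      (eapply is_derive_ext; [|eassumption]; intro t; cbv beta; rewrite sum_O; reflexivity).
  - rewrite sum_Sn; destruct (is_Cderive_plus _ _ _ _ _ IH (F (S N))) as [F1 F2]; split;
      (eapply is_derive_ext; [|eassumption]; intro t; cbv beta; rewrite sum_Sn; reflexivity).
Qed.

(** * The semigroup of self-maps of the disc behind the Cesaro operator *)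

(** Under w = z / (1 - z) the map [cphi] becomes multiplication by u; this explains the semigroup
    and the formula for its denominator. [cpsi] stands for phi / z, kept separate so that z = 0
    needs no division. *)
Definition cden (z : C) (u : R) : C := Cminus (RtoC 1) (Cmult (Cminus (RtoC 1) (RtoC u)) z).
Definition cpsi (z : C) (u : R) : C := Cmult (RtoC u) (Cinv (cden z u)).
Definition cphi (z : C) (u : R) : C := Cmult z (cpsi z u).

Lemma Cmod_cden_ge (z : C) (u : R) :
  0 <= u <= 1 -> 1 - (1 - u) * Cmod z <= Cmod (cden z u).
Proof.
  intro Hu; unfold cden.
  rewrite <- RtoC_minus.
  assert (H := Cmod_triangle (Cminus (RtoC 1) (Cmult (RtoC (1 - u)) z)) (Cmult (RtoC (1 - u)) z)).
  replace (Cplus (Cminus (RtoC 1) (Cmult (RtoC (1 - u)) z)) (Cmult (RtoC (1 - u)) z))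
    with (RtoC 1) in H by ring.
  rewrite Cmod_1, Cmod_mult, Cmod_R, (Rabs_pos_eq (1 - u)) in H by lra; lra.
Qed.

Lemma cden_lower (r u : R) : 0 <= r < 1 -> 0 <= u <= 1 -> 1 - r <= 1 - (1 - u) * r.
Proof. intros; nra. Qed.

Lemma cden_neq_0 (z : C) (u : R) : in_disc z -> 0 <= u <= 1 -> cden z u <> RtoC 0.
Proof.
  intros Hz Hu; apply Cmod_gt_0.
  assert (H := Cmod_cden_ge z u Hu); assert (H2 := Cmod_ge_0 z).
  assert (H3 := cden_lower (Cmod z) u (conj H2 Hz) Hu).
  unfold in_disc in Hz; lra.
Qed.

Lemma Cmod_cphi_le (z : C) (u : R) :
  in_disc z -> 0 <= u <= 1 -> Cmod (cphi z u) <= u * Cmod z / (1 - (1 - u) * Cmod z).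
Proof.
  intros Hz Hu; unfold in_disc in Hz.
  assert (H2 := Cmod_ge_0 z); assert (H3 := cden_lower (Cmod z) u (conj H2 Hz) Hu).
  unfold cphi, cpsi; rewrite !Cmod_mult, Cmod_inv, Cmod_R, (Rabs_pos_eq u)
    by (now apply cden_neq_0 || lra).
  replace (Cmod z * (u * / Cmod (cden z u))) with (u * Cmod z * / Cmod (cden z u)) by ring.
  apply Rmult_le_compat_l; [nra|].
  apply Rinv_le_contravar; [lra|now apply Cmod_cden_ge].
Qed.

Lemma rphi_le (r u : R) :
  0 <= r < 1 -> 0 <= u <= 1 -> u * r / (1 - (1 - u) * r) <= r.
Proof.
  intros Hr Hu; assert (H3 := cden_lower r u Hr Hu).
  apply Rmult_le_reg_r with (1 - (1 - u) * r); [lra|].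
  unfold Rdiv; rewrite Rmult_assoc, Rinv_l by lra.
  assert (0 <= r * ((1 - u) * (1 - r))) by (repeat apply Rmult_le_pos; lra); lra.
Qed.

Lemma is_Cderive_cden (z : C) (u : R) : is_Cderive (cden z) u z.
Proof.
  unfold cden.
  assert (H := is_Cderive_plus _ _ _ _ _ (is_Cderive_const (RtoC 1) u)
    (is_Cderive_scal (Copp z) _ _ _ (is_Cderive_plus _ _ _ _ _ (is_Cderive_const (RtoC 1) u)
      (is_Cderive_scal (Copp (RtoC 1)) _ _ _ (is_Cderive_RtoC u))))).
  match type of H with is_Cderive _ _ ?l => replace l with z in H by ring end.
  destruct H as [H1 H2]; split.
  - refine (is_derive_ext _ _ _ _ _ H1); intro t; f_equal; ring.
  - refine (is_derive_ext _ _ _ _ _ H2); intro t; f_equal; ring.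
Qed.

Lemma is_Cderive_cpsi (z : C) (u : R) : in_disc z -> 0 <= u <= 1 ->
  is_Cderive (cpsi z) u
    (Cmult (Cminus (RtoC 1) z) (Cmult (Cinv (cden z u)) (Cinv (cden z u)))).
Proof.
  intros Hz Hu; assert (Hn := cden_neq_0 z u Hz Hu).
  assert (H := is_Cderive_mult _ _ _ _ _ (is_Cderive_RtoC u)
    (is_Cderive_inv _ _ _ Hn (is_Cderive_cden z u))).
  replace (Cmult (Cminus (RtoC 1) z) _) with
    (Cplus (Cmult (RtoC 1) (Cinv (cden z u)))
       (Cmult (RtoC u) (Copp (Cdiv z (Cmult (cden z u) (cden z u)))))); [exact H|].
  unfold cden in *; field; exact Hn.
Qed.

Lemma one_minus_cphi (z : C) (u : R) : in_disc z -> 0 <= u <= 1 ->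
  Cminus (RtoC 1) (cphi z u) = Cmult (Cminus (RtoC 1) z) (Cinv (cden z u)).
Proof.
  intros Hz Hu; assert (Hn := cden_neq_0 z u Hz Hu).
  unfold cphi, cpsi, cden in *; field; exact Hn.
Qed.

Lemma Csum_Sn (f : nat -> C) (N : nat) : sum_n f (S N) = Cplus (sum_n f N) (f (S N)).
Proof. exact (sum_Sn f N). Qed.

(** * A termwise primitive of f (phi_u) / D_u *)

(** Finite form of sum s_n w^n = f (w) / (1 - w), with s_n the partial sums of the coefficients; the
    boundary term s_N w^(N+1) is estimated later. *)
Lemma abel_sum (a : nat -> C) (w : C) (N : nat) :
  Cmult (Cminus (RtoC 1) w) (sum_n (fun n => Cmult (sum_n a n) (pow_n w n)) N) =
  Cminus (sum_n (fun n => Cmult (a n) (pow_n w n)) N) (Cmult (sum_n a N) (pow_n w (S N))).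
Proof.
  induction N as [|N IH].
  - rewrite !sum_O; simpl.
    change (@mult C_Ring w one) with (Cmult w (RtoC 1)); change (@one C_Ring) with (RtoC 1); ring.
  - rewrite (Csum_Sn (fun n => Cmult (sum_n a n) (pow_n w n))), (Csum_Sn a),
      (Csum_Sn (fun n => Cmult (a n) (pow_n w n))).
    change (pow_n w (S (S N))) with (Cmult w (pow_n w (S N))).
    revert IH.
    generalize (sum_n (fun n => Cmult (sum_n a n) (pow_n w n)) N); intro X.
    generalize (sum_n (fun n => Cmult (a n) (pow_n w n)) N); intro Y.
    generalize (pow_n w (S N)), (sum_n a N), (a (S N)).
    intros p s b IH.
    transitivity (Cplus (Cmult (Cminus (RtoC 1) w) X)
      (Cmult (Cminus (RtoC 1) w) (Cmult (Cplus s b) p))); [ring|].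
    rewrite IH; ring.
Qed.

Ltac Cring := match goal with |- ?x = ?y => change (@eq C x y) end; ring.

Lemma pow_n_Cmult (x y : C) (n : nat) : pow_n (Cmult x y) n = Cmult (pow_n x n) (pow_n y n).
Proof.
  induction n as [|n IH].
  - change (RtoC 1 = Cmult (RtoC 1) (RtoC 1)); ring.
  - change (Cmult (Cmult x y) (pow_n (Cmult x y) n)
            = Cmult (Cmult x (pow_n x n)) (Cmult y (pow_n y n))).
    rewrite IH; ring.
Qed.

Lemma Csum_n_mult_r (f : nat -> C) (c : C) (N : nat) :
  sum_n (fun n => Cmult (f n) c) N = Cmult (sum_n f N) c.
Proof.
  induction N as [|N IH]; [now rewrite !sum_O|].
  rewrite !Csum_Sn, IH; symmetry; apply Cmult_plus_distr_r.
Qed.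

(** Truncation of phi C f (phi) / z, the primitive in u of f (phi) / D that vanishes at u = 0 and
    equals C f (z) at u = 1. *)
Definition cesaro_partial (a : nat -> C) (z : C) (N : nat) (u : R) : C :=
  sum_n (fun n => Cmult (Cmult (cesaro a n) (pow_n z n)) (pow_n (cpsi z u) (S n))) N.

Definition cesaro_partial_deriv (a : nat -> C) (z : C) (N : nat) (u : R) : C :=
  Cmult (Cinv (cden z u))
    (Cplus (sum_n (fun n => Cmult (a n) (pow_n (cphi z u) n)) N)
           (Cmult (Copp (sum_n a N)) (pow_n (cphi z u) (S N)))).

(** The factor n + 1 of the power rule cancels the 1 / (n + 1) of the mean, which leaves s_n phi^n
    psi' in each term and prepares the summation by parts. *)
Lemma is_Cderive_cesaro_partial (a : nat -> C) (z : C) (N : nat) (u : R) :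
  in_disc z -> 0 <= u <= 1 ->
  is_Cderive (cesaro_partial a z N) u (cesaro_partial_deriv a z N u).
Proof.
  intros Hz Hu.
  set (p := Cmult (Cminus (RtoC 1) z) (Cmult (Cinv (cden z u)) (Cinv (cden z u)))).
  replace (cesaro_partial_deriv a z N u)
    with (sum_n (fun n => Cmult (Cmult (sum_n a n) (pow_n (cphi z u) n)) p) N).
  - apply is_Cderive_sum_n; intro n.
    replace (Cmult (Cmult (sum_n a n) (pow_n (cphi z u) n)) p) with
      (Cmult (Cmult (cesaro a n) (pow_n z n))
         (Cmult (Cmult (RtoC (INR (S n))) (pow_n (cpsi z u) n)) p)).
    + apply is_Cderive_scal, is_Cderive_pow_n; now apply is_Cderive_cpsi.
    + unfold cesaro, cphi; rewrite pow_n_Cmult.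
      assert (Hn : INR (S n) <> 0) by (apply not_0_INR; lia).
      rewrite RtoC_inv by exact Hn.
      generalize (pow_n (cpsi z u) n), (pow_n z n), (sum_n a n); intros; field.
      intro E; apply Hn; now apply RtoC_inj.
  - rewrite Csum_n_mult_r; unfold p, cesaro_partial_deriv.
    rewrite (Cmult_assoc (Cminus (RtoC 1) z)), <- one_minus_cphi by assumption.
    assert (A := abel_sum a (cphi z u) N).
    revert A; generalize (sum_n (fun n => Cmult (sum_n a n) (pow_n (cphi z u) n)) N); intro X.
    generalize (sum_n (fun n => Cmult (a n) (pow_n (cphi z u) n)) N); intro Y.
    intro A.
    transitivity (Cmult (Cinv (cden z u)) (Cmult (Cminus (RtoC 1) (cphi z u)) X)); [Cring|].
    rewrite A; Cring.
Qed.

Lemma is_Cderive_continuous_Re (f : R -> C) (u : R) (l : C) :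
  is_Cderive f u l -> continuous (fun x => Re (f x)) u.
Proof.
  intros [H _]; apply (ex_derive_continuous (fun x => Re (f x))); eexists; exact H.
Qed.

Lemma continuous_cesaro_partial_deriv (a : nat -> C) (z theta : C) (N : nat) (u : R) :
  in_disc z -> 0 <= u <= 1 ->
  continuous (fun x => Re (Cmult theta (cesaro_partial_deriv a z N x))) u.
Proof.
  intros Hz Hu.
  assert (Hp : exists l, is_Cderive (cphi z) u l).
  { eexists; exact (is_Cderive_scal z _ _ _ (is_Cderive_cpsi z u Hz Hu)). }
  destruct Hp as [l Hp].
  eapply is_Cderive_continuous_Re, is_Cderive_scal.
  apply is_Cderive_mult.
  - apply is_Cderive_inv; [now apply cden_neq_0|apply is_Cderive_cden].
  - apply is_Cderive_plus.
    (* Continuity is drawn from differentiability. The derivatives are named here because the power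
       rule covers exponents [S n] only, so the constant term needs its own case. *)
    + apply (is_Cderive_sum_n (fun n x => Cmult (a n) (pow_n (cphi z x) n)) u
        (fun n => Cmult (a n) (match n with
           | O => RtoC 0
           | S m => Cmult (Cmult (RtoC (INR (S m))) (pow_n (cphi z u) m)) l end))).
      intros [|n]; apply is_Cderive_scal.
      * exact (is_Cderive_const (RtoC 1) u).
      * apply is_Cderive_pow_n; exact Hp.
    + apply is_Cderive_scal, is_Cderive_pow_n; exact Hp.
Qed.

Lemma cesaro_partial_0 (a : nat -> C) (z : C) (N : nat) : cesaro_partial a z N 0 = RtoC 0.
Proof.
  unfold cesaro_partial.
  assert (E : forall n, Cmult (Cmult (cesaro a n) (pow_n z n)) (pow_n (cpsi z 0) (S n)) = RtoC 0).
  { intro n; change (pow_n (cpsi z 0) (S n)) with (Cmult (cpsi z 0) (pow_n (cpsi z 0) n)).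
    unfold cpsi at 1; Cring. }
  induction N as [|N IH]; [now rewrite sum_O|].
  rewrite Csum_Sn, IH, E; Cring.
Qed.

Lemma pow_n_C1 (n : nat) : pow_n (RtoC 1) n = RtoC 1.
Proof.
  induction n as [|n IH]; [reflexivity|].
  change (Cmult (RtoC 1) (pow_n (RtoC 1) n) = RtoC 1); rewrite IH; ring.
Qed.

Lemma cesaro_partial_1 (a : nat -> C) (z : C) (N : nat) :
  cesaro_partial a z N 1 = sum_n (fun n => Cmult (cesaro a n) (pow_n z n)) N.
Proof.
  assert (E : cpsi z 1 = RtoC 1).
  { unfold cpsi, cden; rewrite <- RtoC_minus; replace (1 - 1) with 0 by ring.
    replace (Cminus (RtoC 1) (Cmult (RtoC 0) z)) with (RtoC 1) by ring.
    field; exact C1_nz. }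
  apply sum_n_ext; intro n; rewrite E, pow_n_C1; Cring.
Qed.

Lemma Re_le_Cmod (z : C) : Re z <= Cmod z.
Proof. exact (Rle_trans _ _ _ (Rle_abs _) (re_le_Cmod z)). Qed.

Lemma pow_le_1 (x : R) (n : nat) : 0 <= x <= 1 -> x ^ n <= 1.
Proof. intro Hx; rewrite <- (pow1 n); now apply pow_incr. Qed.

(** (N + 1) p^N is at most 1 + p + ... + p^N, as each of these powers is at least p^N; the induction
    proves this comparison multiplied by 1 - p. *)
Lemma INR_pow_le (p : R) (N : nat) : 0 < p < 1 -> INR (S N) * p ^ N <= / (1 - p).
Proof.
  intro Hp.
  assert (H : INR (S N) * p ^ N * (1 - p) <= 1 - p ^ S N).
  { induction N as [|N IH]; [simpl; lra|].
    assert (0 < p ^ N) by (apply pow_lt; lra).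
    rewrite (S_INR (S N)); simpl pow in *.
    assert (INR (S N) * (p * p ^ N) * (1 - p) <= p * (1 - p * p ^ N)) by nra.
    assert (p * p ^ N <= 1) by (apply (pow_le_1 p (S N)); lra).
    assert (0 <= (1 - p) * (1 - p * p ^ N)) by (apply Rmult_le_pos; lra).
    nra. }
  assert (0 < p ^ S N) by (apply pow_lt; lra).
  apply Rmult_le_reg_r with (1 - p); [lra|].
  rewrite Rinv_l by lra; lra.
Qed.

(* Since [psi' = (1 - phi) / D], summation by parts turns the derivative of
   [sum_(n <= N) c_n z^n psi^(n+1)] into [(f_N (phi) - s_N phi^(N+1)) / D], so
   integrating over [0, 1] and letting [N] grow yields
   [C f (z) = int_0^1 f (phi_u z) / D_u du] in the form of an inequality. *)
Lemma Re_cesaro_le_RInt (a : nat -> C) (z theta : C) (K : R -> R) :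
  analytic_disc a -> in_disc z ->
  (forall u, 0 <= u <= 1 -> continuous K u) ->
  (forall u, 0 <= u <= 1 ->
     Re (Cmult theta (Cmult (Cinv (cden z u)) (psum a (cphi z u)))) <= K u) ->
  Re (Cmult theta (psum (cesaro a) z)) <= RInt K 0 1.
Proof.
  intros Ha Hz HK HKle.
  set (r := Cmod z); assert (Hr : 0 <= r < 1) by (split; [apply Cmod_ge_0|exact Hz]).
  (* This choice gives r <= p^3, since p^3 - r = (1 - p)^2 (2 + p). In the bound p^(3N) for
     |phi|^(N+1), one factor p^N absorbs the growth of s_N, one the factor N + 1 that this costs,
     and one remains as rate of decay. For the tails, p^3 is read as q rho with q = p^2 and rho =
     p. *)
  set (p := (2 + r) / 3); assert (Hp : 0 < p < 1) by (unfold p; lra).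
  assert (Hrp : r <= p * p * p).
  { assert (0 <= (1 - p) * (1 - p) * (2 + p)) by (repeat apply Rmult_le_pos; lra).
    unfold p in *; nra. }
  assert (Hq : 0 <= p * p < 1) by nra.
  destruct (analytic_disc_coef_bound a p Ha Hp) as [M [HM0 HM]].
  assert (HMc := cesaro_coef_bound a p M HM Hp).
  (* Up to the factor p^N, [B] bounds the error in the integrand for all u, with 1 / (1 - r)
     estimating 1 / |D|, and [B'] bounds the truncation error of C f at the point z itself. *)
  set (B := Cmod theta * (2 * (M / (1 - p * p)) + M * / (1 - p)) * / (1 - r)).
  set (B' := Cmod theta * (2 * (M / (1 - p * p)))).
  assert (Hth := Cmod_ge_0 theta).
  assert (Hqp : forall N, (p * p) ^ S N <= p ^ N).
  { intro N; rewrite Rpow_mult_distr; simpl.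
    assert (0 < p ^ N <= 1) by (split; [apply pow_lt; lra|apply pow_le_1; lra]).
    assert (p * p ^ N <= 1) by nra. assert (0 <= p * p ^ N) by nra. nra. }
  assert (Htail : forall b w N, coef_bound b p M -> Cmod w <= r ->
    Cmod (Cminus (psum b w) (sum_n (fun k => Cmult (b k) (pow_n w k)) N))
      <= 2 * (M / (1 - p * p)) * p ^ N).
  { intros b w N Hb Hw.
    eapply Rle_trans;
      [apply (psum_tail b p M (p * p) w N Hb ltac:(lra) Hq); lra|].
    assert (0 <= M / (1 - p * p)) by (apply Rdiv_le_0_compat; lra).
    replace (M * (p * p) ^ S N / (1 - p * p)) with (M / (1 - p * p) * (p * p) ^ S N)
      by (field; lra).
    specialize (Hqp N); nra. }
  assert (Hstep : forall N, Re (Cmult theta (psum (cesaro a) z)) <= RInt K 0 1 + (B + B') * p ^ N).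
  { intro N.
    assert (Hint : is_RInt (fun u => Re (Cmult theta (cesaro_partial_deriv a z N u))) 0 1
      (minus (Re (Cmult theta (cesaro_partial a z N 1)))
             (Re (Cmult theta (cesaro_partial a z N 0))))).
    { apply (is_RInt_derive (fun u => Re (Cmult theta (cesaro_partial a z N u)))
               (fun u => Re (Cmult theta (cesaro_partial_deriv a z N u)))).
      - intros u Hu; rewrite Rmin_left, Rmax_right in Hu by lra.
        exact (proj1 (is_Cderive_scal theta _ _ _ (is_Cderive_cesaro_partial a z N u Hz Hu))).
      - intros u Hu; rewrite Rmin_left, Rmax_right in Hu by lra.
        now apply continuous_cesaro_partial_deriv. }
    rewrite cesaro_partial_0, cesaro_partial_1 in Hint.
    assert (HKi : is_RInt K 0 1 (RInt K 0 1)).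
    { apply (RInt_correct K), ex_RInt_continuous; intros u Hu.
      rewrite Rmin_left, Rmax_right in Hu by lra; now apply HK. }
    assert (HKB := is_RInt_plus _ _ _ _ _ _ HKi (is_RInt_const 0 1 (B * p ^ N))).
    assert (Hle := is_RInt_le _ _ 0 1 _ _ Rle_0_1 Hint HKB).
    assert (Hsum : Re (Cmult theta (sum_n (fun n => Cmult (cesaro a n) (pow_n z n)) N))
                   <= RInt K 0 1 + B * p ^ N).
    { replace (Cmult theta (RtoC 0)) with (RtoC 0) in Hle by ring.
      change ((forall u, 0 < u < 1 ->
                 Re (Cmult theta (cesaro_partial_deriv a z N u)) <= K u + B * p ^ N) ->
              Re (Cmult theta (sum_n (fun n => Cmult (cesaro a n) (pow_n z n)) N)) + - 0
                <= RInt K 0 1 + (1 - 0) * (B * p ^ N)) in Hle.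
      enough (HP : forall u, 0 < u < 1 ->
                 Re (Cmult theta (cesaro_partial_deriv a z N u)) <= K u + B * p ^ N)
        by (specialize (Hle HP); lra).
      clear Hle; intros u Hu.
      assert (Hu' : 0 <= u <= 1) by lra.
      specialize (HKle u Hu').
      assert (Hphi : Cmod (cphi z u) <= r).
      { eapply Rle_trans; [now apply Cmod_cphi_le|now apply rphi_le]. }
      assert (Hd : 1 - r <= Cmod (cden z u)).
      { eapply Rle_trans; [|now apply Cmod_cden_ge]; now apply cden_lower. }
      assert (Hdi : Cmod (Cinv (cden z u)) <= / (1 - r)).
      { rewrite Cmod_inv by (now apply cden_neq_0); apply Rinv_le_contravar; lra. }
      assert (T := Htail a (cphi z u) N HM Hphi).
      assert (S1 : Cmod (Cmult (sum_n a N) (pow_n (cphi z u) (S N))) <= M * / (1 - p) * p ^ N).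
      { rewrite Cmod_mult, Cmod_pow_n.
        assert (HS := Cmod_sum_n_coef_bound a p M N HM Hp).
        assert (HI := INR_pow_le p N Hp).
        assert (HpN : 0 < p ^ N) by (apply pow_lt; lra).
        assert (Hpw : Cmod (cphi z u) ^ S N <= p ^ N * (p ^ N * p ^ N)).
        { apply Rle_trans with ((p * p * p) ^ S N).
          - apply pow_incr; split; [apply Cmod_ge_0|lra].
          - rewrite !Rpow_mult_distr; simpl pow.
            assert (0 <= p * p ^ N <= p ^ N) by nra.
            assert (p * p ^ N * (p * p ^ N) <= p ^ N * p ^ N) by nra.
            assert (0 <= p * p ^ N * (p * p ^ N)) by nra.
            nra. }
        assert (H0 := Cmod_ge_0 (sum_n a N)).
        apply Rle_trans with (Cmod (sum_n a N) * (p ^ N * (p ^ N * p ^ N))).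
        { now apply Rmult_le_compat_l. }
        apply Rle_trans with (INR (S N) * M * (p ^ N * p ^ N)).
        { rewrite <- Rmult_assoc; apply Rmult_le_compat_r; [nra|exact HS]. }
        replace (INR (S N) * M * (p ^ N * p ^ N)) with (M * (INR (S N) * p ^ N) * p ^ N) by ring.
        apply Rmult_le_compat_r; [lra|]; now apply Rmult_le_compat_l. }
      unfold cesaro_partial_deriv.
      set (X := sum_n (fun n => Cmult (a n) (pow_n (cphi z u) n)) N) in *.
      set (Y := Cmult (sum_n a N) (pow_n (cphi z u) (S N))) in *.
      (* The discrepancy between theta f (phi) / D and theta times the derivative of the truncated
         primitive: the tail of f at phi plus the boundary term of the summation by parts. *)
      set (E := Cmult theta (Cmult (Cinv (cden z u)) (Cplus (Cminus (psum a (cphi z u)) X) Y))).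
      replace (Cmult theta (Cmult (Cinv (cden z u)) (Cplus X _)))
        with (Cminus (Cmult theta (Cmult (Cinv (cden z u)) (psum a (cphi z u)))) E)
        by (unfold E, Y; ring).
      assert (HE : Cmod E <= B * p ^ N).
      { unfold E; rewrite !Cmod_mult.
        assert (TT := Cmod_triangle (Cminus (psum a (cphi z u)) X) Y).
        assert (G0 := Cmod_ge_0 (Cinv (cden z u))).
        assert (G1 := Cmod_ge_0 (Cplus (Cminus (psum a (cphi z u)) X) Y)).
        unfold B.
        replace (Cmod theta * (2 * (M / (1 - p * p)) + M * / (1 - p)) * / (1 - r) * p ^ N)
          with (Cmod theta * (/ (1 - r) * ((2 * (M / (1 - p * p)) + M * / (1 - p)) * p ^ N)))
          by ring.
        apply Rmult_le_compat_l; [exact Hth|].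
        apply Rmult_le_compat; [exact G0|exact G1|exact Hdi|lra]. }
      assert (HR := re_le_Cmod E).
      apply Rabs_le_between in HR.
      change (Re (Cminus (Cmult theta (Cmult (Cinv (cden z u)) (psum a (cphi z u)))) E))
        with (Re (Cmult theta (Cmult (Cinv (cden z u)) (psum a (cphi z u)))) + - Re E).
      lra. }
    assert (T := Htail (cesaro a) z N HMc (Rle_refl _)).
    set (X := sum_n (fun n => Cmult (cesaro a n) (pow_n z n)) N) in *.
    assert (HR := Re_le_Cmod (Cmult theta (Cminus (psum (cesaro a) z) X))).
    rewrite Cmod_mult in HR.
    replace (Re (Cmult theta (Cminus (psum (cesaro a) z) X)))
      with (Re (Cmult theta (psum (cesaro a) z)) - Re (Cmult theta X)) in HR
      by (unfold Re; simpl; ring).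
    assert (Cmod theta * Cmod (Cminus (psum (cesaro a) z) X) <= B' * p ^ N).
    { unfold B'; rewrite Rmult_assoc; now apply Rmult_le_compat_l. }
    lra. }
  assert (HL : is_lim_seq (fun N => RInt K 0 1 + (B + B') * p ^ N) (RInt K 0 1 + (B + B') * 0)).
  { apply is_lim_seq_plus'; [apply is_lim_seq_const|].
    apply (is_lim_seq_scal_l (fun N => p ^ N) (B + B') 0).
    apply is_lim_seq_geom; rewrite Rabs_pos_eq; lra. }
  assert (H := is_lim_seq_le _ _ _ _ Hstep (is_lim_seq_const _) HL).
  change (Re (Cmult theta (psum (cesaro a) z)) <= RInt K 0 1 + (B + B') * 0) in H; lra.
Qed.

(** * The weight and the integral kernel *)

Definition logw (alpha s : R) : R := ln (2 * exp (/ alpha) / (1 - s ^ 2)).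
Definition rweight (alpha s : R) : R := Rpower (1 - s ^ 2) alpha * logw alpha s.
Definition rden (r u : R) : R := 1 - (1 - u) * r.
Definition rphi (r u : R) : R := u * r / rden r u.
Definition kern (alpha r u : R) : R :=
  rweight alpha r * / (rweight alpha (rphi r u) * rden r u).

Lemma one_minus_sqr_bounds (s : R) : 0 <= s < 1 -> 0 < 1 - s ^ 2 <= 1.
Proof. intro Hs; simpl; nra. Qed.

Lemma ln_le_0 (y : R) : 0 < y <= 1 -> ln y <= 0.
Proof. intro Hy; rewrite <- ln_1; apply ln_le; lra. Qed.

Lemma exp_le_compat (x y : R) : x <= y -> exp x <= exp y.
Proof. intros [H| ->]; [left; now apply exp_increasing|apply Rle_refl]. Qed.

Lemma ln_2_bounds : 0 < ln 2 <= 1.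
Proof.
  split; [rewrite <- ln_1; apply ln_increasing; lra|].
  rewrite <- (ln_exp 1); apply ln_le; [lra|].
  pose proof (exp_ineq1_le 1); lra.
Qed.

Lemma logw_eq (alpha s : R) : 0 <= s < 1 -> logw alpha s = ln 2 + / alpha - ln (1 - s ^ 2).
Proof.
  intro Hs; assert (H := one_minus_sqr_bounds s Hs); unfold logw.
  assert (He := exp_pos (/ alpha)).
  rewrite ln_div, ln_mult, ln_exp by lra; reflexivity.
Qed.

Lemma logw_ge (alpha s : R) : 0 <= s < 1 -> / alpha <= logw alpha s.
Proof.
  intro Hs; rewrite logw_eq by exact Hs.
  assert (H := ln_le_0 _ (one_minus_sqr_bounds s Hs)); pose proof ln_2_bounds; lra.
Qed.

Lemma logw_pos (alpha s : R) : 0 < alpha -> 0 <= s < 1 -> 0 < logw alpha s.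
Proof.
  intros Ha Hs; eapply Rlt_le_trans; [apply (Rinv_0_lt_compat _ Ha)|now apply logw_ge].
Qed.

Lemma rweight_pos (alpha s : R) : 0 < alpha -> 0 <= s < 1 -> 0 < rweight alpha s.
Proof.
  intros Ha Hs; apply Rmult_lt_0_compat; [apply exp_pos|now apply logw_pos].
Qed.

Lemma logw_incr (alpha s t : R) : 0 <= s <= t -> t < 1 -> logw alpha s <= logw alpha t.
Proof.
  intros Hst Ht; rewrite !logw_eq by lra.
  assert (ln (1 - t ^ 2) <= ln (1 - s ^ 2)); [|lra].
  apply ln_le; [apply one_minus_sqr_bounds; lra|simpl; nra].
Qed.

(* With [y1 <= y2] the two values of [1 - s^2], [(y2/y1)^alpha >= 1 + alpha ln (y2/y1)]
   and [alpha * logw >= 1]; this is what the constant [exp (/ alpha)] is for. *)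
Lemma rweight_decr (alpha s t : R) :
  0 < alpha -> 0 <= s <= t -> t < 1 -> rweight alpha t <= rweight alpha s.
Proof.
  intros Ha Hst Ht.
  assert (H1 := logw_ge alpha s ltac:(lra)).
  assert (Hl : ln (1 - t ^ 2) <= ln (1 - s ^ 2)).
  { apply ln_le; [apply one_minus_sqr_bounds; lra|simpl; nra]. }
  assert (E : logw alpha t = logw alpha s + (ln (1 - s ^ 2) - ln (1 - t ^ 2)))
    by (rewrite !logw_eq by lra; ring).
  unfold rweight, Rpower; rewrite E.
  set (x := ln (1 - s ^ 2) - ln (1 - t ^ 2)) in *.
  replace (alpha * ln (1 - s ^ 2)) with (alpha * ln (1 - t ^ 2) + alpha * x) by (unfold x; ring).
  rewrite exp_plus, Rmult_assoc; apply Rmult_le_compat_l; [left; apply exp_pos|].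
  assert (Hx : 0 <= x) by (unfold x; lra).
  assert (He := exp_ineq1_le (alpha * x)).
  assert (H2 : 1 <= alpha * logw alpha s).
  { replace 1 with (alpha * / alpha) by (field; lra); apply Rmult_le_compat_l; lra. }
  assert (H3 : 0 < logw alpha s) by (pose proof (Rinv_0_lt_compat _ Ha); lra).
  apply Rle_trans with ((1 + alpha * x) * logw alpha s); [nra|].
  apply Rmult_le_compat_r; lra.
Qed.

Lemma rden_bounds (r u : R) : 0 <= r < 1 -> 0 <= u <= 1 ->
  1 - r <= rden r u <= 1 /\ u <= rden r u.
Proof. intros Hr Hu; unfold rden; repeat split; nra. Qed.

Lemma rphi_bounds (r u : R) : 0 <= r < 1 -> 0 <= u <= 1 -> 0 <= rphi r u <= r.
Proof.
  intros Hr Hu; split; [|now apply rphi_le].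
  apply Rdiv_le_0_compat; [nra|].
  pose proof (rden_bounds r u Hr Hu); lra.
Qed.

Lemma rphi_disc (r u : R) : 0 <= r < 1 -> 0 <= u <= 1 -> 0 <= rphi r u < 1.
Proof. intros Hr Hu; pose proof (rphi_bounds r u Hr Hu); lra. Qed.

Lemma kern_den_pos (alpha r u : R) : 0 < alpha -> 0 <= r < 1 -> 0 <= u <= 1 ->
  0 < rweight alpha (rphi r u) * rden r u.
Proof.
  intros Ha Hr Hu; apply Rmult_lt_0_compat.
  - apply rweight_pos; [exact Ha|now apply rphi_disc].
  - pose proof (rden_bounds r u Hr Hu); lra.
Qed.

Lemma kern_pos (alpha r u : R) : 0 < alpha -> 0 <= r < 1 -> 0 <= u <= 1 -> 0 < kern alpha r u.
Proof.
  intros Ha Hr Hu; apply Rmult_lt_0_compat; [now apply rweight_pos|].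
  now apply Rinv_0_lt_compat, kern_den_pos.
Qed.

(** The weight decreases and rphi <= r, so the quotient of weights is at most 1. The bound blows up
    as r tends to 1 and serves only, for fixed r, to make a short interval at u = 0 negligible. *)
Lemma kern_le_const (alpha r u : R) : 0 < alpha -> 0 <= r < 1 -> 0 <= u <= 1 ->
  kern alpha r u <= / (1 - r).
Proof.
  intros Ha Hr Hu; unfold kern.
  assert (Hp := rphi_bounds r u Hr Hu); assert (Hd := rden_bounds r u Hr Hu).
  assert (H1 := rweight_decr alpha _ _ Ha Hp ltac:(lra)).
  assert (H2 := rweight_pos alpha r Ha Hr).
  apply Rle_trans with (rweight alpha r * / (rweight alpha r * (1 - r))).
  - apply Rmult_le_compat_l; [lra|]; apply Rinv_le_contravar; [nra|].
    apply Rmult_le_compat; lra.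
  - right; field; lra.
Qed.

(** D^2 - (u r)^2 factors as (D - u r) (D + u r), with D - u r = 1 - r; the other factor is the
    origin of 1 - (1 - 2 e^-t) r in the norm formula. *)
Lemma one_minus_rphi_sqr (r u : R) : 0 <= r < 1 -> 0 <= u <= 1 ->
  ln (1 - rphi r u ^ 2) = ln (1 - r) + ln (1 - (1 - 2 * u) * r) - 2 * ln (rden r u).
Proof.
  intros Hr Hu; assert (Hd := rden_bounds r u Hr Hu).
  assert (HE : 0 < 1 - (1 - 2 * u) * r) by nra.
  replace (1 - rphi r u ^ 2) with ((1 - r) * (1 - (1 - 2 * u) * r) / (rden r u * rden r u)).
  - rewrite ln_div, !ln_mult by nra; ring.
  - unfold rphi; replace (rden r u) with (1 - (1 - u) * r) in * by reflexivity; field; lra.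
Qed.

Lemma ln_one_minus_sqr (r : R) : 0 <= r < 1 -> ln (1 - r ^ 2) = ln (1 - r) + ln (1 + r).
Proof. intro Hr; rewrite <- ln_mult by lra; f_equal; ring. Qed.

(** The factor (1 - r)^alpha occurs in both weights and cancels. The remaining powers are gathered
    in one exponential, so that estimates of the kernel become linear inequalities between
    logarithms. *)
Lemma kern_exp (alpha r u : R) : 0 < alpha -> 0 <= r < 1 -> 0 <= u <= 1 ->
  kern alpha r u =
  exp (alpha * ln (1 + r) + (2 * alpha - 1) * ln (rden r u)
       - alpha * ln (1 - (1 - 2 * u) * r))
  * (logw alpha r / logw alpha (rphi r u)).
Proof.
  intros Ha Hr Hu; assert (Hd := rden_bounds r u Hr Hu).
  assert (HL := logw_pos alpha _ Ha (rphi_disc r u Hr Hu)).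
  unfold kern, rweight, Rpower.
  rewrite one_minus_rphi_sqr, ln_one_minus_sqr by assumption.
  rewrite <- (exp_ln (rden r u)) at 2 by lra.
  set (d := ln (rden r u)); set (e := ln (1 - (1 - 2 * u) * r)).
  replace (alpha * ln (1 + r) + (2 * alpha - 1) * d - alpha * e) with
    (alpha * (ln (1 - r) + ln (1 + r)) + - (alpha * (ln (1 - r) + e - 2 * d)) + - d) by ring.
  rewrite 2!exp_plus, 2!exp_Ropp.
  assert (H1 := exp_pos d); assert (H2 := exp_pos (alpha * (ln (1 - r) + e - 2 * d))).
  field; lra.
Qed.

Lemma logw_diff (alpha r u : R) : 0 <= r < 1 -> 0 <= u <= 1 ->
  logw alpha r - logw alpha (rphi r u) =
  ln (1 - (1 - 2 * u) * r) - ln (1 + r) - 2 * ln (rden r u).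
Proof.
  intros Hr Hu; rewrite !logw_eq by (assumption || now apply rphi_disc).
  rewrite one_minus_rphi_sqr, ln_one_minus_sqr by assumption; ring.
Qed.

Lemma norm_integrand_kern (alpha r t : R) : 0 < alpha -> 0 <= r < 1 -> 0 <= t ->
  norm_integrand alpha r t = exp (- t) * kern alpha r (exp (- t)).
Proof.
  intros Ha Hr Ht; assert (Hu : 0 <= exp (- t) <= 1).
  { split; [left; apply exp_pos|]; rewrite <- exp_0; apply exp_le_compat; lra. }
  unfold norm_integrand; revert Hu; generalize (exp (- t)); intros u Hu.
  rewrite kern_exp by assumption.
  fold (rden r u); fold (rphi r u).
  fold (logw alpha r); fold (logw alpha (rphi r u)).
  assert (HL := logw_pos alpha _ Ha (rphi_disc r _ Hr Hu)).
  unfold Rpower.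
  replace (alpha * ln (1 + r) + (2 * alpha - 1) * ln (rden r u)
           - alpha * ln (1 - (1 - 2 * u) * r))
    with (alpha * ln (1 + r) + (2 * alpha - 1) * ln (rden r u)
          + - (alpha * ln (1 - (1 - 2 * u) * r))) by ring.
  rewrite 2!exp_plus, exp_Ropp.
  assert (H2 := exp_pos (alpha * ln (1 - (1 - 2 * u) * r))).
  field; lra.
Qed.

Lemma continuous_kern (alpha r u : R) : 0 < alpha -> 0 <= r < 1 -> 0 <= u <= 1 ->
  continuous (kern alpha r) u.
Proof.
  intros Ha Hr Hu; apply (ex_derive_continuous (kern alpha r)).
  assert (Hd := rden_bounds r u Hr Hu).
  assert (Hk := kern_den_pos alpha r u Ha Hr Hu).
  assert (Hs := one_minus_sqr_bounds _ (rphi_disc r u Hr Hu)).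
  unfold kern, rweight, logw, Rpower, rphi, rden in *.
  auto_derive.
  assert (He := exp_pos (/ alpha)).
  repeat split; try lra.
  - exact (proj1 Hs).
  - apply Rgt_not_eq; exact (proj1 Hs).
  - apply (Rdiv_lt_0_compat (2 * exp (/ alpha))); [lra|exact (proj1 Hs)].
  - apply Rgt_not_eq; exact Hk.
Qed.

(** * The improper integral in t as an integral of the kernel over [0, 1] *)

Lemma ex_RInt_kern (alpha r a b : R) :
  0 < alpha -> 0 <= r < 1 -> 0 <= a <= b -> b <= 1 -> ex_RInt (kern alpha r) a b.
Proof.
  intros Ha Hr Hab Hb; apply (ex_RInt_continuous (kern alpha r)); intros u Hu.
  rewrite Rmin_left, Rmax_right in Hu by lra; apply continuous_kern; lra.
Qed.

Lemma RInt_kern_Chasles (alpha r e : R) :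
  0 < alpha -> 0 <= r < 1 -> 0 <= e <= 1 ->
  RInt (kern alpha r) 0 1 = RInt (kern alpha r) 0 e + RInt (kern alpha r) e 1.
Proof.
  intros Ha Hr He; symmetry.
  apply (RInt_Chasles (kern alpha r)); apply ex_RInt_kern; lra.
Qed.

Lemma RInt_kern_near_0 (alpha r e : R) :
  0 < alpha -> 0 <= r < 1 -> 0 <= e <= 1 ->
  0 <= RInt (kern alpha r) 0 e <= e * / (1 - r).
Proof.
  intros Ha Hr He; split.
  - apply RInt_ge_0; [lra|apply ex_RInt_kern; lra|].
    intros u Hu; left; apply kern_pos; lra.
  - replace (e * / (1 - r)) with (RInt (fun _ => / (1 - r)) 0 e)
      by (rewrite RInt_const; unfold scal; simpl; unfold mult; simpl; ring).
    apply RInt_le; [lra|apply ex_RInt_kern; lra|apply ex_RInt_const|].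
    intros u Hu; apply kern_le_const; lra.
Qed.

Lemma is_RInt_norm_integrand (alpha r T : R) :
  0 < alpha -> 0 <= r < 1 -> 0 <= T ->
  is_RInt (norm_integrand alpha r) 0 T (RInt (kern alpha r) (exp (- T)) 1).
Proof.
  intros Ha Hr HT.
  assert (Hu : forall t, 0 <= t -> 0 <= exp (- t) <= 1).
  { intros t Ht; split; [left; apply exp_pos|]; rewrite <- exp_0; apply exp_le_compat; lra. }
  assert (H := is_RInt_comp (kern alpha r) (fun t => exp (- t)) (fun t => - exp (- t)) 0 T).
  cbv beta in H; rewrite Rmin_left, Rmax_right in H by lra.
  assert (H' : is_RInt (fun t => scal (- exp (- t)) (kern alpha r (exp (- t)))) 0 T
                 (RInt (kern alpha r) (exp (- 0)) (exp (- T)))).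
  { apply H.
    - intros t Ht; apply continuous_kern; [exact Ha|exact Hr|apply Hu; lra].
    - intros t Ht; split; [auto_derive; [trivial|ring]|].
      apply (ex_derive_continuous (fun t => - exp (- t))); auto_derive; trivial. }
  rewrite Ropp_0, exp_0 in H'.
  assert (H2 := is_RInt_opp _ _ _ _ H').
  (* The substitution t -> e^-t reverses orientation; the sign of its derivative compensates the
     exchange of end points. *)
  rewrite <- (opp_RInt_swap (kern alpha r) 1 (exp (- T))).
  - eapply is_RInt_ext; [|exact H2].
    intros t Ht; rewrite Rmin_left, Rmax_right in Ht by lra.
    rewrite norm_integrand_kern by (assumption || lra).
    unfold opp, scal; simpl; unfold mult; simpl; ring.
  - apply ex_RInt_swap, ex_RInt_kern; try assumption; [apply Hu|]; lra.
Qed.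

(** [RInt_gen] is a total function; convergence to this value is what makes [norm_integral] a
    genuine improper integral. *)
Lemma is_RInt_gen_norm_integrand (alpha r : R) :
  0 < alpha -> 0 <= r < 1 ->
  is_RInt_gen (norm_integrand alpha r) (at_point 0) (Rbar_locally p_infty)
    (RInt (kern alpha r) 0 1).
Proof.
  intros Ha Hr P [eps HP].
  assert (Hd : 0 < eps * (1 - r)) by (apply Rmult_lt_0_compat; [apply cond_pos|lra]).
  (* Beyond this threshold the missing interval [0, e^-T] contributes at most e^-T / (1 - r) < eps;
     the maximum with 0 keeps T positive. *)
  apply (Filter_prod _ _ _ (fun x => x = 0)
           (fun T => Rmax 0 (- ln (eps * (1 - r))) < T)).
  - reflexivity.
  - exists (Rmax 0 (- ln (eps * (1 - r)))); trivial.
  - intros x T -> HT; simpl.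
    assert (HT0 : 0 < T) by (eapply Rle_lt_trans; [apply Rmax_l|exact HT]).
    assert (HT1 : - ln (eps * (1 - r)) < T) by (eapply Rle_lt_trans; [apply Rmax_r|exact HT]).
    exists (RInt (kern alpha r) (exp (- T)) 1); split.
    + apply is_RInt_norm_integrand; lra.
    + apply HP.
      assert (Hu : 0 <= exp (- T) <= 1).
      { split; [left; apply exp_pos|]; rewrite <- exp_0; apply exp_le_compat; lra. }
      assert (C := RInt_kern_Chasles alpha r _ Ha Hr Hu).
      assert (B := RInt_kern_near_0 alpha r _ Ha Hr Hu).
      assert (E : exp (- T) < eps * (1 - r)).
      { rewrite <- (exp_ln (eps * (1 - r))) by exact Hd; apply exp_increasing; lra. }
      assert (E2 : exp (- T) * / (1 - r) < eps).
      { apply Rmult_lt_reg_r with (1 - r); [lra|].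
        rewrite Rmult_assoc, Rinv_l by lra; lra. }
      change (Rabs (RInt (kern alpha r) (exp (- T)) 1 - RInt (kern alpha r) 0 1) < eps).
      rewrite C; apply Rabs_def1; lra.
Qed.

Lemma norm_integral_kern (alpha r : R) :
  0 < alpha -> 0 <= r < 1 -> norm_integral alpha r = RInt (kern alpha r) 0 1.
Proof.
  intros Ha Hr.
  exact (is_RInt_gen_unique _ _ (is_RInt_gen_norm_integrand alpha r Ha Hr)).
Qed.

(** * Bounds for the kernel by powers, and their integrals *)

(** The powers contribute at most 2 D^(alpha-1), since D <= 1 - (1 - 2u) r. The logarithms differ by
    at most -2 log D and the lower one is at least 1, so their quotient is at most 1 - 2 log D,
    hence at most (4/alpha) D^(-alpha/2) by e^x >= 1 + x. Finally u <= D and the exponent is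
    negative. *)
Lemma kern_le_power (alpha r u : R) : 0 < alpha < 1 -> 0 <= r < 1 -> 0 < u <= 1 ->
  kern alpha r u <= 8 / alpha * Rpower u (alpha / 2 - 1).
Proof.
  intros Ha Hr Hu; assert (Hu' : 0 <= u <= 1) by lra.
  assert (Hd := rden_bounds r u Hr Hu').
  assert (HL := logw_pos alpha _ (proj1 Ha) (rphi_disc r u Hr Hu')).
  assert (HLr := logw_pos alpha _ (proj1 Ha) Hr).
  assert (HL1 : 1 <= logw alpha (rphi r u)).
  { eapply Rle_trans; [|apply logw_ge; now apply rphi_disc].
    rewrite <- Rinv_1; apply Rinv_le_contravar; lra. }
  assert (HD := logw_diff alpha r u Hr Hu').
  rewrite kern_exp by (assumption || lra).
  assert (Hd0 := ln_le_0 (rden r u) ltac:(lra)).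
  assert (Hlu : ln u <= ln (rden r u)) by (apply ln_le; lra).
  assert (He1 : ln (rden r u) <= ln (1 - (1 - 2 * u) * r)) by (apply ln_le; unfold rden in *; nra).
  assert (He2 : ln (1 - (1 - 2 * u) * r) <= ln (1 + r)) by (apply ln_le; nra).
  assert (H12 : 0 <= ln (1 + r)) by (rewrite <- ln_1; apply ln_le; lra).
  assert (H12' : ln (1 + r) <= ln 2) by (apply ln_le; lra).
  set (d := ln (rden r u)) in *; set (e := ln (1 - (1 - 2 * u) * r)) in *.
  assert (HQ : logw alpha r / logw alpha (rphi r u) <= 4 / alpha * exp (- (alpha / 2 * d))).
  { apply Rle_trans with (1 - 2 * d).
    - apply Rmult_le_reg_r with (logw alpha (rphi r u)); [lra|].
      unfold Rdiv; rewrite Rmult_assoc, Rinv_l by lra. nra.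
    - assert (Hx := exp_ineq1_le (- (alpha / 2 * d))).
      assert (H4 : 4 <= 4 / alpha).
      { apply Rmult_le_reg_r with alpha; [lra|]; unfold Rdiv; rewrite Rmult_assoc, Rinv_l by lra; lra. }
      apply Rle_trans with (4 / alpha * (1 + - (alpha / 2 * d))); [|apply Rmult_le_compat_l; lra].
      replace (4 / alpha * (1 + - (alpha / 2 * d))) with (4 / alpha - 2 * d) by (field; lra); lra. }
  assert (HP : exp (alpha * ln (1 + r) + (2 * alpha - 1) * d - alpha * e)
               <= 2 * exp ((alpha - 1) * d)).
  { rewrite <- (exp_ln 2) at 2 by lra; rewrite <- exp_plus; apply exp_le_compat.
    assert (alpha * ln (1 + r) <= ln 2) by nra.
    assert (alpha * d <= alpha * e) by nra. lra. }
  apply Rle_trans with (2 * exp ((alpha - 1) * d) * (4 / alpha * exp (- (alpha / 2 * d)))).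
  { apply Rmult_le_compat; [left; apply exp_pos|left; now apply Rdiv_lt_0_compat|exact HP|exact HQ]. }
  replace (2 * exp ((alpha - 1) * d) * (4 / alpha * exp (- (alpha / 2 * d))))
    with (8 / alpha * (exp ((alpha - 1) * d) * exp (- (alpha / 2 * d)))) by (field; lra).
  apply Rmult_le_compat_l; [left; apply Rdiv_lt_0_compat; lra|].
  rewrite <- exp_plus; apply exp_le_compat.
  replace ((alpha - 1) * d + - (alpha / 2 * d)) with ((alpha / 2 - 1) * d) by field.
  nra.
Qed.

Lemma is_derive_Rpower (x y : R) : 0 < x ->
  is_derive (fun t => Rpower t y) x (y * Rpower x (y - 1)).
Proof. intro Hx; apply is_derive_Reals; now apply derivable_pt_lim_power. Qed.

Lemma continuous_Rpower (x y : R) : 0 < x -> continuous (fun t => Rpower t y) x.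
Proof.
  intro Hx; apply (ex_derive_continuous (fun t => Rpower t y)).
  eexists; now apply is_derive_Rpower.
Qed.

Lemma is_RInt_Rpower (y a b : R) : 0 < y -> 0 < a <= b ->
  is_RInt (fun t => Rpower t (y - 1)) a b ((Rpower b y - Rpower a y) / y).
Proof.
  intros Hy Hab.
  replace ((Rpower b y - Rpower a y) / y)
    with (minus (/ y * Rpower b y) (/ y * Rpower a y))
    by (unfold minus, plus, opp; simpl; field; lra).
  apply (is_RInt_derive (fun t => / y * Rpower t y) (fun t => Rpower t (y - 1)));
    intros t Ht; rewrite Rmin_left, Rmax_right in Ht by lra.
  - replace (Rpower t (y - 1)) with (/ y * (y * Rpower t (y - 1))) by (field; lra).
    apply (is_derive_scal (fun t => Rpower t y)), is_derive_Rpower; lra.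
  - apply continuous_Rpower; lra.
Qed.

Lemma Rpower_1_l (y : R) : Rpower 1 y = 1.
Proof. unfold Rpower; rewrite ln_1, Rmult_0_r; apply exp_0. Qed.

(** The constant is 8/alpha times int_0^1 u^(alpha/2-1) du = 2/alpha, the same for all r. As that
    power is singular at 0, [0, e] is split off, where e <= eps (1 - r) makes the crude bound on the
    kernel cost at most eps. *)
Lemma RInt_kern_le (alpha r : R) : 0 < alpha < 1 -> 0 <= r < 1 ->
  RInt (kern alpha r) 0 1 <= 16 / alpha ^ 2.
Proof.
  intros Ha Hr; apply le_epsilon; intros eps Heps.
  set (e := Rmin (1 / 2) (eps * (1 - r))).
  assert (He : 0 < e < 1).
  { unfold e; split; [apply Rmin_glb_lt; [lra|nra]|].
    eapply Rle_lt_trans; [apply Rmin_l|lra]. }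
  assert (C := RInt_kern_Chasles alpha r e (proj1 Ha) Hr ltac:(lra)).
  assert (B := RInt_kern_near_0 alpha r e (proj1 Ha) Hr ltac:(lra)).
  assert (E2 : e * / (1 - r) <= eps).
  { apply Rmult_le_reg_r with (1 - r); [lra|].
    rewrite Rmult_assoc, Rinv_l by lra; rewrite Rmult_1_r; apply Rmin_r. }
  assert (I := is_RInt_scal _ _ _ (8 / alpha) _
    (is_RInt_Rpower (alpha / 2) e 1 ltac:(lra) ltac:(lra))).
  assert (J := RInt_correct (kern alpha r) e 1
    (ex_RInt_kern alpha r e 1 (proj1 Ha) Hr ltac:(lra) ltac:(lra))).
  assert (L := is_RInt_le _ _ e 1 _ _ ltac:(lra) J I).
  assert (L' : RInt (kern alpha r) e 1 <= 8 / alpha * ((Rpower 1 (alpha / 2) - Rpower e (alpha / 2)) / (alpha / 2))).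
  { apply L; intros u Hu; apply (kern_le_power alpha r u); lra. }
  rewrite Rpower_1_l in L'.
  assert (H0 : 0 < Rpower e (alpha / 2)) by apply exp_pos.
  replace (8 / alpha * ((1 - Rpower e (alpha / 2)) / (alpha / 2)))
    with (16 / alpha ^ 2 * (1 - Rpower e (alpha / 2))) in L' by (field; lra).
  assert (0 < 16 / alpha ^ 2) by (apply Rdiv_lt_0_compat; [lra|apply pow_lt; lra]).
  nra.
Qed.

(** The quotient of logarithms is at least 1 because rphi <= r. Also 1 - (1 - 2u) r <= 2 D, which
    leaves ((1+r)/2)^alpha D^(alpha-1), and ((1+r)/2)^alpha >= (1+r)/2 as alpha < 1. *)
Lemma kern_ge_power (alpha r u : R) : 0 < alpha < 1 -> 0 <= r < 1 -> 0 <= u <= 1 ->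
  (1 + r) / 2 * Rpower (rden r u) (alpha - 1) <= kern alpha r u.
Proof.
  intros Ha Hr Hu; assert (Hd := rden_bounds r u Hr Hu).
  assert (HL := logw_pos alpha _ (proj1 Ha) (rphi_disc r u Hr Hu)).
  assert (HI := logw_incr alpha _ _ (rphi_bounds r u Hr Hu) (proj2 Hr)).
  rewrite kern_exp by (assumption || lra).
  assert (He : ln (1 - (1 - 2 * u) * r) <= ln 2 + ln (rden r u)).
  { rewrite <- ln_mult by lra; apply ln_le; unfold rden in *; nra. }
  assert (H12 : ln (1 + r) <= ln 2) by (apply ln_le; lra).
  unfold Rpower; set (d := ln (rden r u)) in *.
  set (e := ln (1 - (1 - 2 * u) * r)) in *.
  rewrite <- (exp_ln ((1 + r) / 2)), <- exp_plus, ln_div by lra.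
  rewrite <- (Rmult_1_r (exp (ln (1 + r) - ln 2 + _))).
  apply Rmult_le_compat; [left; apply exp_pos|lra|apply exp_le_compat|].
  - assert (ln (1 + r) - ln 2 <= alpha * (ln (1 + r) - ln 2)) by nra.
    assert (alpha * e <= alpha * (ln 2 + d)) by nra. lra.
  - apply Rmult_le_reg_r with (logw alpha (rphi r u)); [lra|].
    unfold Rdiv; rewrite Rmult_assoc, Rinv_l by lra; lra.
Qed.

(** D has slope r in u, so D^alpha / (alpha r) is a primitive of D^(alpha-1); this is where r > 0
    enters. The resulting factor 1/r >= 1 is then dropped. *)
Lemma RInt_kern_ge (alpha r : R) : 0 < alpha < 1 -> 0 < r < 1 ->
  (1 + r) / 2 * ((1 - Rpower (1 - r) alpha) / alpha) <= RInt (kern alpha r) 0 1.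
Proof.
  intros Ha Hr; assert (Hr' : 0 <= r < 1) by lra.
  assert (I : is_RInt (fun u => (1 + r) / 2 * Rpower (rden r u) (alpha - 1)) 0 1
    (minus ((1 + r) / 2 * (Rpower (rden r 1) alpha / (alpha * r)))
           ((1 + r) / 2 * (Rpower (rden r 0) alpha / (alpha * r))))).
  { apply (is_RInt_derive (fun u => (1 + r) / 2 * (Rpower (rden r u) alpha / (alpha * r)))
             (fun u => (1 + r) / 2 * Rpower (rden r u) (alpha - 1)));
      intros u Hu; rewrite Rmin_left, Rmax_right in Hu by lra;
      assert (Hd := rden_bounds r u Hr' Hu).
    - apply (is_derive_scal (fun u => Rpower (rden r u) alpha / (alpha * r))).
      replace (Rpower (rden r u) (alpha - 1))
        with (scal r (alpha * Rpower (rden r u) (alpha - 1)) * / (alpha * r))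
        by (unfold scal; simpl; unfold mult; simpl; field; lra).
      apply (is_derive_scal_l (fun u => Rpower (rden r u) alpha)
        u _ (/ (alpha * r))).
      apply (is_derive_comp (fun x => Rpower x alpha) (rden r)).
      + apply is_derive_Rpower; lra.
      + unfold rden; auto_derive; [trivial|ring].
    - apply (continuous_scal_r ((1 + r) / 2) (fun u => Rpower (rden r u) (alpha - 1))).
      apply (continuous_comp (rden r) (fun x => Rpower x (alpha - 1))).
      + apply (ex_derive_continuous (rden r)); unfold rden; auto_derive; trivial.
      + apply continuous_Rpower; lra. }
  assert (J := RInt_correct (kern alpha r) 0 1
    (ex_RInt_kern alpha r 0 1 (proj1 Ha) Hr' ltac:(lra) ltac:(lra))).
  assert (L := is_RInt_le _ _ 0 1 _ _ Rle_0_1 I J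
    (fun u Hu => kern_ge_power alpha r u Ha Hr' ltac:(lra))).
  eapply Rle_trans; [|exact L].
  unfold minus, plus, opp; simpl.
  unfold rden; replace (1 - (1 - 1) * r) with 1 by ring.
  replace (1 - (1 - 0) * r) with (1 - r) by ring; rewrite Rpower_1_l.
  assert (HX : Rpower (1 - r) alpha <= 1).
  { assert (H := ln_le_0 (1 - r) ltac:(lra)).
    apply Rle_trans with (exp 0); [apply exp_le_compat; nra|rewrite exp_0; lra]. }
  replace ((1 + r) / 2 * (1 / (alpha * r)) + - ((1 + r) / 2 * (Rpower (1 - r) alpha / (alpha * r))))
    with ((1 + r) / 2 * ((1 - Rpower (1 - r) alpha) / alpha) * / r) by (field; lra).
  rewrite <- (Rmult_1_r (_ * (_ / alpha))) at 1.
  apply Rmult_le_compat_l.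
  - apply Rmult_le_pos; [lra|apply Rdiv_le_0_compat; lra].
  - rewrite <- Rinv_1; apply Rinv_le_contravar; lra.
Qed.

(** * An extremal function with nonnegative Taylor coefficients *)

Lemma Series_zero (f : nat -> R) : (forall n, f n = 0) -> Series f = 0.
Proof.
  intro Hf; rewrite (Series_ext f (fun n => 0 * f n)) by (intro n; rewrite Hf; ring).
  rewrite Series_scal_l; ring.
Qed.

Lemma Series_nonneg (f : nat -> R) :
  (forall n, 0 <= f n) -> ex_series f -> 0 <= Series f.
Proof.
  intros Hf He; rewrite <- (Series_zero (fun _ => 0)) by reflexivity.
  apply Series_le; [intro n; split; [apply Rle_refl|apply Hf]|exact He].
Qed.

Lemma CV_radius_bounded_coef (a : nat -> R) (M x : R) :
  (forall n, Rabs (a n) <= M) -> Rabs x < 1 -> Rbar_lt (Rabs x) (CV_radius a).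
Proof.
  intros HM Hx; apply Rbar_lt_le_trans with (Finite 1); [exact Hx|].
  apply (proj1 (CV_radius_bounded a)); exists M; intro n.
  rewrite pow1, Rmult_1_r; apply HM.
Qed.

(** Taylor coefficients of (1 - x)^(-alpha). *)
Fixpoint binom_coef (alpha : R) (n : nat) : R :=
  match n with
  | O => 1
  | S m => binom_coef alpha m * ((INR m + alpha) / INR (S m))
  end.

(** Taylor coefficients of c - log (1 - x). *)
Definition log_coef (c : R) (n : nat) : R :=
  match n with
  | O => c
  | S m => / INR (S m)
  end.

(** Each new coefficient depends on all previous ones, so the structural recursion carries a table
    that is correct for indices up to m; a larger index merely repeats the entry at m. *)
Fixpoint quot_table (c : R) (b l : nat -> R) (m : nat) : nat -> R :=
  match m with
  | O => fun _ => b O / c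
  | S m => fun k =>
      if (k <=? m)%nat then quot_table c b l m k
      else (b (S m) - sum_f_R0 (fun j => quot_table c b l m j * l (S m - j)%nat) m) / c
  end.

(* Coefficients of the quotient of the power series [b] by [c + sum_(n >= 1) l n x^n]. *)
Definition quot_coef (c : R) (b l : nat -> R) (n : nat) : R := quot_table c b l n n.

Lemma quot_table_stable (c : R) (b l : nat -> R) (m k : nat) :
  (k <= m)%nat -> quot_table c b l m k = quot_coef c b l k.
Proof.
  induction m as [|m IH]; intro Hk.
  - now replace k with 0%nat by lia.
  - destruct (Nat.eq_dec k (S m)) as [->|Hne]; [reflexivity|].
    rewrite <- IH by lia; simpl.
    destruct (Nat.leb_spec k m); [reflexivity|lia].
Qed.

Lemma quot_coef_S (c : R) (b l : nat -> R) (m : nat) :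
  quot_coef c b l (S m) =
  (b (S m) - sum_f_R0 (fun j => quot_coef c b l j * l (S m - j)%nat) m) / c.
Proof.
  change (quot_coef c b l (S m)) with
    (if (S m <=? m)%nat then quot_table c b l m (S m)
     else (b (S m) - sum_f_R0 (fun j => quot_table c b l m j * l (S m - j)%nat) m) / c).
  rewrite (proj2 (Nat.leb_gt (S m) m)) by lia.
  f_equal; f_equal; apply sum_eq; intros j Hj; now rewrite quot_table_stable.
Qed.

Lemma PS_mult_quot_coef (c : R) (b l : nat -> R) (n : nat) :
  c <> 0 -> l 0%nat = c -> PS_mult (quot_coef c b l) l n = b n.
Proof.
  intros Hc Hl; unfold PS_mult; destruct n as [|m].
  - simpl; rewrite Hl; unfold quot_coef; simpl; field; exact Hc.
  - rewrite tech5, quot_coef_S, Nat.sub_diag, Hl; field; exact Hc.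
Qed.

(** The factor (m + alpha) / (m + 1) is the ratio of consecutive binomial coefficients. For k >= 1
    the ratio of logarithmic coefficients is k / (k + 1) <= m / (m + 1); for k = 0 it is 1 / c <=
    alpha <= (m + alpha) / (m + 1), which is where c >= 1 / alpha is used. *)
Lemma log_coef_step (alpha c : R) (m k : nat) :
  0 < alpha < 1 -> / alpha <= c -> (k <= m)%nat ->
  log_coef c (S k) <= (INR m + alpha) / INR (S m) * log_coef c k.
Proof.
  intros Ha Hc Hk.
  assert (Hm : 0 <= INR m) by apply pos_INR.
  assert (HSm : 0 < INR (S m)) by (apply lt_0_INR; lia).
  assert (Hac : 1 <= alpha * c).
  { replace 1 with (alpha * / alpha) by (field; lra); apply Rmult_le_compat_l; lra. }
  assert (Hkm : INR k <= INR m) by now apply le_INR.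
  apply Rmult_le_reg_l with (INR (S m)); [exact HSm|].
  replace (INR (S m) * ((INR m + alpha) / INR (S m) * log_coef c k))
    with ((INR m + alpha) * log_coef c k) by (field; lra).
  rewrite S_INR in *; destruct k as [|k].
  - simpl log_coef; rewrite Rinv_1. assert (0 < c) by nra.
    assert (alpha <= 1) by lra. assert (1 <= c) by nra. nra.
  - simpl log_coef; fold (INR (S (S k))) in *; rewrite !S_INR in *.
    assert (Hk0 : 0 <= INR k) by apply pos_INR.
    change (match k with 0%nat => 1 | S _ => INR k + 1 end) with (INR (S k)).
    rewrite S_INR.
    apply Rmult_le_reg_l with ((INR k + 1) * (INR k + 1 + 1)); [nra|].
    replace ((INR k + 1) * (INR k + 1 + 1) * ((INR m + 1) * / (INR k + 1 + 1)))
      with ((INR k + 1) * (INR m + 1)) by (field; lra).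
    replace ((INR k + 1) * (INR k + 1 + 1) * ((INR m + alpha) * / (INR k + 1)))
      with ((INR k + 1 + 1) * (INR m + alpha)) by (field; lra).
    nra.
Qed.

(* Subtracting [(m + alpha) / (m + 1)] times the equation for the coefficient of index [m]
   from that of index [m + 1] leaves a combination of the previous ones with
   nonnegative coefficients. *)
Lemma quot_coef_nonneg (alpha c : R) (n : nat) :
  0 < alpha < 1 -> / alpha <= c ->
  0 <= quot_coef c (binom_coef alpha) (log_coef c) n.
Proof.
  intros Ha Hc.
  assert (Hc0 : 0 < c) by (pose proof (Rinv_0_lt_compat alpha (proj1 Ha)); lra).
  set (q := quot_coef c (binom_coef alpha) (log_coef c)).
  induction n as [n IH] using (well_founded_induction Wf_nat.lt_wf).
  destruct n as [|m].
  - unfold q, quot_coef; simpl; left; apply Rdiv_lt_0_compat; lra.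
  - unfold q; rewrite quot_coef_S; fold q.
    apply Rdiv_le_0_compat; [|exact Hc0].
    change (binom_coef alpha (S m)) with (binom_coef alpha m * ((INR m + alpha) / INR (S m))).
    rewrite <- (PS_mult_quot_coef c (binom_coef alpha) (log_coef c) m) by (reflexivity || lra).
    fold q; unfold PS_mult.
    rewrite (Rmult_comm (sum_f_R0 _ m)), scal_sum.
    match goal with |- 0 <= ?x - ?y => enough (y <= x) by lra end.
    apply sum_Rle; intros j Hj.
    replace (S m - j)%nat with (S (m - j)) by lia.
    assert (H := log_coef_step alpha c m (m - j) Ha Hc ltac:(lia)).
    specialize (IH j ltac:(lia)).
    assert (0 <= q j * ((INR m + alpha) / INR (S m) * log_coef c (m - j) - log_coef c (S (m - j)))).
    { apply Rmult_le_pos; lra. }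
    lra.
Qed.

Lemma binom_coef_bounds (alpha : R) (n : nat) :
  0 < alpha < 1 -> 0 <= binom_coef alpha n <= 1.
Proof.
  intro Ha; induction n as [|n IH]; [simpl; lra|].
  change (binom_coef alpha (S n)) with (binom_coef alpha n * ((INR n + alpha) / INR (S n))).
  assert (Hn : 0 <= INR n) by apply pos_INR.
  rewrite S_INR.
  assert (0 <= (INR n + alpha) / (INR n + 1) <= 1).
  { split; [apply Rdiv_le_0_compat; lra|].
    apply Rmult_le_reg_r with (INR n + 1); [lra|].
    unfold Rdiv; rewrite Rmult_assoc, Rinv_l by lra; lra. }
  split; [apply Rmult_le_pos; lra|].
  apply Rle_trans with (1 * 1); [apply Rmult_le_compat|]; lra.
Qed.

Lemma log_coef_bounds (c : R) (n : nat) : 1 <= c -> 0 <= log_coef c n <= c.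
Proof.
  intro Hc; destruct n as [|n]; unfold log_coef; [lra|].
  assert (Hn : 0 <= INR n) by apply pos_INR.
  rewrite S_INR; split; [left; apply Rinv_0_lt_compat; lra|].
  apply Rle_trans with 1; [|exact Hc].
  rewrite <- Rinv_1; apply Rinv_le_contravar; lra.
Qed.

(** All terms of the convolution are nonnegative, so its last term q_n c is at most the binomial
    coefficient, hence at most 1, while c >= 1. The upper bound secures convergence on the disc. *)
Lemma quot_coef_bounds (alpha c : R) (n : nat) :
  0 < alpha < 1 -> / alpha <= c ->
  0 <= quot_coef c (binom_coef alpha) (log_coef c) n <= 1.
Proof.
  intros Ha Hc; split; [now apply quot_coef_nonneg|].
  assert (Hc1 : 1 <= c).
  { apply Rle_trans with (/ alpha); [|exact Hc].
    rewrite <- Rinv_1; apply Rinv_le_contravar; lra. }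
  assert (Hb := binom_coef_bounds alpha n Ha).
  set (q := quot_coef c (binom_coef alpha) (log_coef c)).
  assert (Hq : forall k, 0 <= q k) by (intro k; now apply quot_coef_nonneg).
  assert (H : q n * c <= binom_coef alpha n); [|specialize (Hq n); nra].
  rewrite <- (PS_mult_quot_coef c (binom_coef alpha) (log_coef c) n) by (reflexivity || lra).
  fold q; unfold PS_mult; destruct n as [|m]; [simpl; lra|].
  rewrite tech5, Nat.sub_diag.
  assert (0 <= sum_f_R0 (fun k => q k * log_coef c (S m - k)) m).
  { apply cond_pos_sum; intro k; apply Rmult_le_pos; [apply Hq|now apply log_coef_bounds]. }
  simpl (log_coef c 0); lra.
Qed.

(** The recursion of the coefficients is the differential equation (1 - y) B' = alpha B, so B (y) (1
    - y)^alpha is constant and keeps its value 1 at y = 0. *)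
Lemma PSeries_binom_coef (alpha x : R) : 0 < alpha < 1 -> 0 <= x < 1 ->
  PSeries (binom_coef alpha) x * Rpower (1 - x) alpha = 1.
Proof.
  intros Ha Hx.
  assert (Hr : forall y, 0 <= y < 1 -> Rbar_lt (Rabs y) (CV_radius (binom_coef alpha))).
  { intros y Hy; apply (CV_radius_bounded_coef _ 1); [|rewrite Rabs_pos_eq; lra].
    intro n; assert (H := binom_coef_bounds alpha n Ha); rewrite Rabs_pos_eq; lra. }
  assert (Hode : forall y, 0 <= y < 1 ->
    (1 - y) * PSeries (PS_derive (binom_coef alpha)) y = alpha * PSeries (binom_coef alpha) y).
  { intros y Hy; specialize (Hr y Hy).
    assert (E : PSeries (PS_derive (binom_coef alpha)) y
      = alpha * PSeries (binom_coef alpha) y + y * PSeries (PS_derive (binom_coef alpha)) y).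
    { rewrite <- PSeries_scal, <- PSeries_incr_1, <- PSeries_plus.
      - apply PSeries_ext; intro n.
        change (INR (S n) * (binom_coef alpha n * ((INR n + alpha) / INR (S n))) =
                alpha * binom_coef alpha n + PS_incr_1 (PS_derive (binom_coef alpha)) n).
        replace (PS_incr_1 (PS_derive (binom_coef alpha)) n) with (INR n * binom_coef alpha n).
        + field; apply not_0_INR; lia.
        + destruct n as [|n]; [apply Rmult_0_l|reflexivity].
      - apply (ex_pseries_scal alpha); [apply Rmult_comm|now apply CV_radius_inside].
      - apply (ex_pseries_incr_1 (PS_derive (binom_coef alpha))); now apply ex_pseries_derive. }
    lra. }
  destruct (Req_dec x 0) as [->|Hx0].
  { rewrite PSeries_0, Rminus_0_r, Rpower_1_l; simpl; ring. }
  symmetry.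
  assert (E := eq_is_derive (fun y => PSeries (binom_coef alpha) y * Rpower (1 - y) alpha) 0 x).
  cbv beta in E; rewrite <- E; [rewrite PSeries_0, Rminus_0_r, Rpower_1_l; simpl; ring| |lra].
  intros t Ht; specialize (Hr t ltac:(lra)); specialize (Hode t ltac:(lra)).
  assert (D1 := is_derive_PSeries _ _ Hr).
  assert (D2 : is_derive (fun y => Rpower (1 - y) alpha) t (scal (-1) (alpha * Rpower (1 - t) (alpha - 1)))).
  { apply (is_derive_comp (fun x => Rpower x alpha) (fun y => 1 - y)).
    - apply is_derive_Rpower; lra.
    - auto_derive; [trivial|ring]. }
  assert (D := is_derive_Rmult _ _ _ _ _ D1 D2); cbv beta in D.
  replace (@zero R_NormedModule) with
    (PSeries (PS_derive (binom_coef alpha)) t * Rpower (1 - t) alpha +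
     PSeries (binom_coef alpha) t * scal (-1) (alpha * Rpower (1 - t) (alpha - 1))); [exact D|].
  unfold scal, zero; simpl; unfold mult; simpl.
  replace (Rpower (1 - t) alpha) with ((1 - t) * Rpower (1 - t) (alpha - 1)).
  - transitivity (((1 - t) * PSeries (PS_derive (binom_coef alpha)) t
      - alpha * PSeries (binom_coef alpha) t) * Rpower (1 - t) (alpha - 1)); [ring|].
    rewrite Hode; ring.
  - rewrite <- (Rpower_1 (1 - t)) at 1 by lra; rewrite <- Rpower_plus; f_equal; ring.
Qed.

(** The derived series is geometric, with sum 1 / (1 - x), which is opposite to the derivative of
    log (1 - x). *)
Lemma PSeries_log_coef (c x : R) : 1 <= c -> 0 <= x < 1 ->
  PSeries (log_coef c) x = c - ln (1 - x).
Proof.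
  intros Hc Hx.
  assert (Hr : forall y, 0 <= y < 1 -> Rbar_lt (Rabs y) (CV_radius (log_coef c))).
  { intros y Hy; apply (CV_radius_bounded_coef _ c); [|rewrite Rabs_pos_eq; lra].
    intro n; assert (H := log_coef_bounds c n Hc); rewrite Rabs_pos_eq; lra. }
  destruct (Req_dec x 0) as [->|Hx0].
  { rewrite PSeries_0, Rminus_0_r, ln_1; simpl; ring. }
  assert (E := eq_is_derive (fun y => PSeries (log_coef c) y + ln (1 - y)) 0 x).
  cbv beta in E; rewrite PSeries_0, Rminus_0_r, ln_1 in E; simpl (log_coef c 0) in E.
  enough (c + 0 = PSeries (log_coef c) x + ln (1 - x)) by lra.
  apply E; [|lra]; intros t Ht; specialize (Hr t ltac:(lra)).
  assert (D1 := is_derive_PSeries _ _ Hr).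
  assert (D2 : is_derive (fun y => ln (1 - y)) t (- / (1 - t))).
  { auto_derive; [lra|field; lra]. }
  assert (D := is_derive_plus _ _ _ _ _ D1 D2).
  replace (@zero R_NormedModule) with (plus (PSeries (PS_derive (log_coef c)) t) (- / (1 - t)));
    [exact D|].
  replace (PSeries (PS_derive (log_coef c)) t) with (/ (1 - t)).
  - unfold plus, zero; simpl; ring.
  - rewrite <- Series_geom by (rewrite Rabs_pos_eq; lra).
    apply Series_ext; intro n; unfold PS_derive, log_coef.
    rewrite Rinv_r by (apply not_0_INR; lia); ring.
Qed.

(** Value at z = 0 of log (2 e^(1/alpha) / (1 - z^2)), that is, the constant term of the divisor. *)
Definition ext_const (alpha : R) : R := ln 2 + / alpha.
(** The extremal function as a power series in x = z^2; [ext_real] returns to the variable z by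
    inserting zeros at odd indices. *)
Definition ext_half (alpha : R) : nat -> R :=
  quot_coef (ext_const alpha) (binom_coef alpha) (log_coef (ext_const alpha)).
Definition ext_real (alpha : R) (k : nat) : R :=
  if Nat.even k then ext_half alpha (Nat.div2 k) else 0.

(* Taylor coefficients of [1 / ((1 - z^2)^alpha log (2 e^(1/alpha) / (1 - z^2)))]. *)
Definition ext_fun (alpha : R) (k : nat) : C := RtoC (ext_real alpha k).

Lemma ext_const_ge (alpha : R) : 0 < alpha < 1 -> / alpha <= ext_const alpha /\ 1 <= ext_const alpha.
Proof.
  intro Ha; unfold ext_const; pose proof ln_2_bounds.
  assert (1 <= / alpha) by (rewrite <- Rinv_1; apply Rinv_le_contravar; lra); lra.
Qed.

Lemma ext_half_bounds (alpha : R) (n : nat) : 0 < alpha < 1 -> 0 <= ext_half alpha n <= 1.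
Proof. intro Ha; apply quot_coef_bounds; [exact Ha|now apply ext_const_ge]. Qed.

Lemma ext_real_bounds (alpha : R) (n : nat) : 0 < alpha < 1 -> 0 <= ext_real alpha n <= 1.
Proof.
  intro Ha; unfold ext_real; destruct (Nat.even n); [now apply ext_half_bounds|lra].
Qed.

Lemma PSeries_ext_half (alpha s : R) : 0 < alpha < 1 -> 0 <= s < 1 ->
  PSeries (ext_half alpha) (s ^ 2) = / rweight alpha s.
Proof.
  intros Ha Hs; destruct (ext_const_ge alpha Ha) as [Hc Hc1].
  assert (Hx := one_minus_sqr_bounds s Hs).
  assert (Hx' : 0 <= s ^ 2 < 1) by (split; [apply pow2_ge_0|lra]).
  assert (Hr : forall b M, (forall n, 0 <= b n <= M) -> Rbar_lt (Rabs (s ^ 2)) (CV_radius b)).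
  { intros b M Hb; apply (CV_radius_bounded_coef _ M); [|rewrite Rabs_pos_eq; lra].
    intro n; rewrite Rabs_pos_eq; apply Hb. }
  assert (E : PSeries (ext_half alpha) (s ^ 2) * logw alpha s = PSeries (binom_coef alpha) (s ^ 2)).
  { rewrite logw_eq by exact Hs; fold (ext_const alpha).
    rewrite <- PSeries_log_coef by assumption.
    rewrite <- PSeries_mult.
    - apply PSeries_ext; intro n; apply PS_mult_quot_coef; [lra|reflexivity].
    - apply (Hr _ 1); intro n; now apply ext_half_bounds.
    - apply (Hr _ (ext_const alpha)); intro n; now apply log_coef_bounds. }
  assert (F := PSeries_binom_coef alpha (s ^ 2) Ha Hx').
  assert (HL := logw_pos alpha s (proj1 Ha) Hs).
  assert (HP : 0 < Rpower (1 - s ^ 2) alpha) by apply exp_pos.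
  rewrite <- E in F; unfold rweight.
  apply Rmult_eq_reg_r with (Rpower (1 - s ^ 2) alpha * logw alpha s).
  - rewrite Rinv_l by nra; etransitivity; [|exact F]; ring.
  - nra.
Qed.

Lemma PSeries_ext_real (alpha s : R) : 0 < alpha < 1 -> 0 <= s < 1 ->
  PSeries (ext_real alpha) s = / rweight alpha s.
Proof.
  intros Ha Hs; assert (Hx := one_minus_sqr_bounds s Hs).
  assert (Hx' : 0 <= s ^ 2 < 1) by (split; [apply pow2_ge_0|lra]).
  assert (Hev : forall n, ext_real alpha (2 * n) = ext_half alpha n).
  { intro n; unfold ext_real; rewrite Nat.even_mul, Nat.div2_double; reflexivity. }
  assert (Hod : forall n, ext_real alpha (2 * n + 1) = 0).
  { intro n; unfold ext_real; rewrite Nat.even_add, Nat.even_mul; reflexivity. }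
  assert (Hcv : forall b, (forall n, 0 <= b n <= 1) -> ex_pseries b (s ^ 2)).
  { intros b Hb; apply CV_radius_inside, (CV_radius_bounded_coef _ 1); [|rewrite Rabs_pos_eq; lra].
    intro n; rewrite Rabs_pos_eq; apply Hb. }
  rewrite PSeries_odd_even.
  - rewrite (PSeries_ext _ _ _ Hev), PSeries_ext_half by assumption.
    replace (PSeries (fun n => ext_real alpha (2 * n + 1)) (s ^ 2)) with 0; [ring|].
    symmetry; apply Series_zero; intro n; rewrite Hod; ring.
  - apply Hcv; intro n; rewrite Hev; now apply ext_half_bounds.
  - apply Hcv; intro n; rewrite Hod; lra.
Qed.

Lemma ext_fun_coef_bound (alpha rho : R) :
  0 < alpha < 1 -> 0 < rho < 1 -> coef_bound (ext_fun alpha) rho 1.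
Proof.
  intros Ha Hr n; assert (Hb := ext_real_bounds alpha n Ha).
  unfold ext_fun; rewrite Cmod_R, Rabs_pos_eq by lra.
  assert (Hp := pow_le_1 rho n ltac:(lra)); assert (0 < rho ^ n) by (apply pow_lt; lra).
  nra.
Qed.

Lemma ext_fun_analytic (alpha : R) : 0 < alpha < 1 -> analytic_disc (ext_fun alpha).
Proof.
  intro Ha; apply analytic_disc_of_coef_bound; intros rho Hr; exists 1.
  now apply ext_fun_coef_bound.
Qed.

Lemma pow_n_RtoC (x : R) (n : nat) : pow_n (RtoC x) n = RtoC (x ^ n).
Proof.
  induction n as [|n IH]; [reflexivity|].
  change (Cmult (RtoC x) (pow_n (RtoC x) n) = RtoC (x * x ^ n)).
  now rewrite IH, RtoC_mult.
Qed.

Lemma psum_ext_fun_real (alpha s : R) : 0 < alpha < 1 -> 0 <= s < 1 ->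
  psum (ext_fun alpha) (RtoC s) = RtoC (/ rweight alpha s).
Proof.
  intros Ha Hs; rewrite <- PSeries_ext_real by assumption.
  assert (E : forall k, Cmult (ext_fun alpha k) (pow_n (RtoC s) k) = RtoC (ext_real alpha k * s ^ k)).
  { intro k; unfold ext_fun; now rewrite pow_n_RtoC, RtoC_mult. }
  unfold psum, RtoC, PSeries; f_equal.
  - apply Series_ext; intro k; fold (RtoC s); now rewrite E.
  - apply Series_zero; intro k; fold (RtoC s); now rewrite E.
Qed.

Lemma Cmod_sum_n_le (f : nat -> C) (N : nat) :
  Cmod (sum_n f N) <= sum_n (fun k => Cmod (f k)) N.
Proof.
  induction N as [|N IH]; [rewrite !sum_O; apply Rle_refl|].
  rewrite Csum_Sn, sum_Sn; eapply Rle_trans; [apply Cmod_triangle|].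
  now apply Rplus_le_compat_r.
Qed.

Lemma sum_n_le_Series (f : nat -> R) (N : nat) :
  (forall n, 0 <= f n) -> ex_series f -> sum_n f N <= Series f.
Proof.
  intros Hf He; rewrite (Series_incr_n f (S N)) by (lia || exact He); simpl pred.
  rewrite sum_n_Reals.
  assert (0 <= Series (fun k => f (S N + k)%nat)); [|lra].
  apply Series_nonneg; [intro n; apply Hf|].
  now apply (ex_series_incr_n f (S N)).
Qed.

(** Nonnegative coefficients give |f (z)| <= f (|z|) by the triangle inequality, applied to partial
    sums; the geometric tail of [psum] then lets N tend to infinity. *)
Lemma Cmod_psum_ext_fun_le (alpha : R) (z : C) : 0 < alpha < 1 -> in_disc z ->
  Cmod (psum (ext_fun alpha) z) <= / rweight alpha (Cmod z).
Proof.
  intros Ha Hz; set (r := Cmod z).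
  assert (Hr : 0 <= r < 1) by (split; [apply Cmod_ge_0|exact Hz]).
  rewrite <- PSeries_ext_real by assumption.
  set (rho := (r + 1) / 2); set (q := r / rho).
  assert (Hrho : 0 < rho < 1) by (unfold rho; lra).
  assert (Hq : 0 <= q < 1).
  { split; [apply Rdiv_le_0_compat; lra|apply (Rdiv_lt_1 r rho); unfold rho in *; lra]. }
  assert (Hex : ex_series (fun k => ext_real alpha k * r ^ k)).
  { apply (@ex_series_le R_AbsRing R_CompleteNormedModule _ (fun n => 1 * r ^ n));
      [|now apply ex_series_scal_geom].
    intro n; assert (Hb := ext_real_bounds alpha n Ha).
    assert (Hp : 0 <= r ^ n) by (apply pow_le; lra).
    change (Rabs (ext_real alpha n * r ^ n) <= 1 * r ^ n).
    rewrite Rabs_pos_eq by nra; nra. }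
  assert (Hstep : forall N, Cmod (psum (ext_fun alpha) z)
    <= PSeries (ext_real alpha) r + 2 * / (1 - q) * q * q ^ N).
  { intro N.
    assert (T := psum_tail _ rho 1 q z N (ext_fun_coef_bound alpha rho Ha Hrho)
      (proj1 Hrho) Hq ltac:(unfold q; fold r; right; field; lra)).
    set (X := sum_n (fun k => Cmult (ext_fun alpha k) (pow_n z k)) N) in *.
    assert (HX : Cmod X <= PSeries (ext_real alpha) r).
    { eapply Rle_trans; [apply Cmod_sum_n_le|].
      eapply Rle_trans; [|apply (sum_n_le_Series (fun k => ext_real alpha k * r ^ k) N)].
      - right; apply sum_n_ext; intro k.
        unfold ext_fun; rewrite Cmod_mult, Cmod_pow_n, Cmod_R, Rabs_pos_eq; [reflexivity|].
        now apply ext_real_bounds.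
      - intro n; apply Rmult_le_pos; [now apply ext_real_bounds|apply pow_le; lra].
      - exact Hex. }
    assert (TT := Cmod_triangle (Cminus (psum (ext_fun alpha) z) X) X).
    replace (Cplus (Cminus (psum (ext_fun alpha) z) X) X) with (psum (ext_fun alpha) z) in TT by ring.
    simpl pow in T; unfold Rdiv in T; lra. }
  assert (HL : is_lim_seq (fun N => PSeries (ext_real alpha) r + 2 * / (1 - q) * q * q ^ N)
                 (PSeries (ext_real alpha) r + 2 * / (1 - q) * q * 0)).
  { apply is_lim_seq_plus'; [apply is_lim_seq_const|].
    apply (is_lim_seq_scal_l (fun N => q ^ N) (2 * / (1 - q) * q) 0).
    apply is_lim_seq_geom; rewrite Rabs_pos_eq; lra. }
  assert (H := is_lim_seq_le _ _ _ _ Hstep (is_lim_seq_const _) HL).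
  change (Cmod (psum (ext_fun alpha) z) <= PSeries (ext_real alpha) r + 2 * / (1 - q) * q * 0) in H.
  lra.
Qed.

(** * The operator norm *)

Lemma kweight_rweight (alpha : R) (z : C) : kweight alpha z = rweight alpha (Cmod z).
Proof. reflexivity. Qed.

Lemma RInt_kern_nonneg (alpha r : R) : 0 < alpha -> 0 <= r < 1 -> 0 <= RInt (kern alpha r) 0 1.
Proof. intros Ha Hr; apply (RInt_kern_near_0 alpha r 1 Ha Hr); lra. Qed.

Lemma RInt_scal_kern (alpha r c : R) : 0 < alpha -> 0 <= r < 1 ->
  RInt (fun u => c * kern alpha r u) 0 1 = c * RInt (kern alpha r) 0 1.
Proof.
  intros Ha Hr; apply (RInt_scal (kern alpha r) 0 1 c), ex_RInt_kern; lra.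
Qed.

Lemma continuous_scal_kern (alpha r c u : R) : 0 < alpha -> 0 <= r < 1 -> 0 <= u <= 1 ->
  continuous (fun u => c * kern alpha r u) u.
Proof.
  intros Ha Hr Hu; apply (continuous_scal_r c (kern alpha r)); now apply continuous_kern.
Qed.

(** With W = C f (z) and theta the conjugate of W, the real part to be estimated is |W|^2. One
    factor |W| is divided out at the end, so W = 0 is treated apart. *)
Lemma kweight_cesaro_le (alpha M : R) (a : nat -> C) (z : C) :
  0 < alpha -> analytic_disc a -> in_disc z ->
  (forall w, in_disc w -> kweight alpha w * Cmod (psum a w) <= M) ->
  kweight alpha z * Cmod (psum (cesaro a) z) <= M * RInt (kern alpha (Cmod z)) 0 1.
Proof.
  intros Ha Han Hz HM; rewrite kweight_rweight.
  set (r := Cmod z); assert (Hr : 0 <= r < 1) by (split; [apply Cmod_ge_0|exact Hz]).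
  set (W := psum (cesaro a) z).
  assert (HW := Cmod_ge_0 W); assert (Hv := rweight_pos alpha r Ha Hr).
  assert (HM0 : 0 <= M).
  { eapply Rle_trans; [|apply (HM z Hz)]; apply Rmult_le_pos;
      [left; exact Hv|apply Cmod_ge_0]. }
  assert (HI := RInt_kern_nonneg alpha r Ha Hr).
  destruct HW as [HW|HW]; [|rewrite <- HW, Rmult_0_r; now apply Rmult_le_pos].
  assert (H : Re (Cmult (Cconj W) W)
    <= RInt (fun u => Cmod W * M * / rweight alpha r * kern alpha r u) 0 1).
  { apply Re_cesaro_le_RInt; [exact Han|exact Hz| |].
    - intros u Hu; now apply continuous_scal_kern.
    - intros u Hu; eapply Rle_trans; [apply Re_le_Cmod|].
      assert (Hd := rden_bounds r u Hr Hu); assert (Hp := rphi_disc r u Hr Hu).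
      assert (Hn := cden_neq_0 z u Hz Hu).
      assert (Hcd : rden r u <= Cmod (cden z u)) by now apply Cmod_cden_ge.
      assert (Hcp : Cmod (cphi z u) <= rphi r u) by now apply Cmod_cphi_le.
      assert (Hcd1 : in_disc (cphi z u)) by (unfold in_disc; lra).
      specialize (HM _ Hcd1); rewrite kweight_rweight in HM.
      assert (Hdec := rweight_decr alpha _ _ Ha (conj (Cmod_ge_0 (cphi z u)) Hcp) (proj2 Hp)).
      assert (Hvp := rweight_pos alpha _ Ha Hp).
      assert (Hf0 := Cmod_ge_0 (psum a (cphi z u))).
      rewrite !Cmod_mult, Cmod_conj, Cmod_inv by exact Hn.
      replace (Cmod W * M * / rweight alpha r * kern alpha r u)
        with (Cmod W * (/ rden r u * (M * / rweight alpha (rphi r u))))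
        by (unfold kern; field; lra).
      apply Rmult_le_compat_l; [lra|].
      apply Rmult_le_compat; [left; apply Rinv_0_lt_compat; lra|exact Hf0| |].
      + apply Rinv_le_contravar; lra.
      + apply Rmult_le_reg_r with (rweight alpha (rphi r u)); [exact Hvp|].
        rewrite Rmult_assoc, Rinv_l, Rmult_1_r by lra; nra. }
  rewrite RInt_scal_kern in H by assumption.
  replace (Re (Cmult (Cconj W) W)) with (Cmod W * Cmod W) in H.
  - apply Rmult_le_reg_l with (Cmod W); [exact HW|].
    apply Rle_trans with (rweight alpha r * (Cmod W * Cmod W)); [right; ring|].
    apply Rle_trans with (rweight alpha r * (Cmod W * M * / rweight alpha r * RInt (kern alpha r) 0 1)).
    + apply Rmult_le_compat_l; lra.
    + right; field; lra.
  - rewrite <- (Rmult_1_r (Cmod W * _)), Rmult_assoc.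
    transitivity (Cmod W ^ 2); [simpl; ring|rewrite Cmod2_alt].
    unfold Re, Im, Cconj; simpl; ring.
Qed.

Lemma cphi_RtoC (r u : R) : 0 <= r < 1 -> 0 <= u <= 1 ->
  cphi (RtoC r) u = RtoC (rphi r u) /\ Cinv (cden (RtoC r) u) = RtoC (/ rden r u).
Proof.
  intros Hr Hu; assert (Hd := rden_bounds r u Hr Hu).
  assert (E : cden (RtoC r) u = RtoC (rden r u)).
  { unfold cden, rden; now rewrite <- RtoC_minus, <- RtoC_mult, <- RtoC_minus. }
  assert (E2 : Cinv (cden (RtoC r) u) = RtoC (/ rden r u)).
  { rewrite E, RtoC_inv by lra; reflexivity. }
  split; [|exact E2].
  unfold cphi, cpsi; rewrite E2, <- !RtoC_mult; f_equal; unfold rphi; field; lra.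
Qed.

(** At z = r everything under the integral is real and f (phi) = 1 / v (phi) exactly, so theta = -1
    turns the upper estimate of the real part into the lower estimate needed. *)
Lemma kweight_cesaro_ext_fun_ge (alpha r : R) : 0 < alpha < 1 -> 0 <= r < 1 ->
  RInt (kern alpha r) 0 1
    <= kweight alpha (RtoC r) * Cmod (psum (cesaro (ext_fun alpha)) (RtoC r)).
Proof.
  intros Ha Hr; set (W := psum (cesaro (ext_fun alpha)) (RtoC r)).
  assert (Hv := rweight_pos alpha r (proj1 Ha) Hr).
  assert (Hmod : Cmod (RtoC r) = r) by (rewrite Cmod_R, Rabs_pos_eq; lra).
  assert (H : Re (Cmult (RtoC (-1)) W)
    <= RInt (fun u => - / rweight alpha r * kern alpha r u) 0 1).
  { apply Re_cesaro_le_RInt; [now apply ext_fun_analytic|unfold in_disc; lra| |].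
    - intros u Hu; apply continuous_scal_kern; lra.
    - intros u Hu; destruct (cphi_RtoC r u Hr Hu) as [-> ->].
      assert (Hd := rden_bounds r u Hr Hu); assert (Hp := rphi_disc r u Hr Hu).
      assert (Hvp := rweight_pos alpha _ (proj1 Ha) Hp).
      rewrite psum_ext_fun_real, <- !RtoC_mult by assumption.
      right; unfold kern; simpl; field; lra. }
  rewrite RInt_scal_kern in H by (assumption || lra).
  replace (Re (Cmult (RtoC (-1)) W)) with (- Re W) in H by (unfold Re; simpl; ring).
  assert (HR := Re_le_Cmod W); rewrite kweight_rweight, Hmod.
  apply Rmult_le_reg_l with (/ rweight alpha r); [now apply Rinv_0_lt_compat|].
  rewrite <- Rmult_assoc, Rinv_l, Rmult_1_l by lra; lra.
Qed.

Lemma is_finite_Lub_Rbar (E : R -> Prop) (x0 M : R) :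
  E x0 -> (forall x, E x -> x <= M) -> is_finite (Lub_Rbar E).
Proof.
  intros H0 HM; destruct (Lub_Rbar_correct E) as [Hub Hlub].
  specialize (Hub x0 H0); specialize (Hlub (Finite M) HM).
  now destruct (Lub_Rbar E).
Qed.

Lemma in_disc_0 : in_disc (RtoC 0).
Proof. unfold in_disc; rewrite Cmod_0; lra. Qed.

(** The inequality is between reals, and the coercion from [Rbar] sends infinite values to 0;
    finiteness is therefore proved together with it. *)
Lemma hnorm_finite (alpha M : R) (a : nat -> C) :
  (forall z, in_disc z -> kweight alpha z * Cmod (psum a z) <= M) ->
  is_finite (hnorm alpha a) /\ hnorm alpha a <= M.
Proof.
  intro HM.
  assert (Hub : forall x,
    (exists z : C, in_disc z /\ x = kweight alpha z * Cmod (psum a z)) -> x <= M).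
  { intros x [z [Hz ->]]; now apply HM. }
  assert (Hf : is_finite (hnorm alpha a)).
  { eapply is_finite_Lub_Rbar; [|exact Hub]; exists (RtoC 0); split; [exact in_disc_0|reflexivity]. }
  split; [exact Hf|].
  assert (H := proj2 (Lub_Rbar_correct _) (Finite M) Hub).
  fold (hnorm alpha a) in H; now rewrite <- Hf in H.
Qed.

Lemma kweight_le_hnorm (alpha : R) (a : nat -> C) (z : C) :
  in_disc z -> Rbar_le (kweight alpha z * Cmod (psum a z)) (hnorm alpha a).
Proof.
  intro Hz; apply (proj1 (Lub_Rbar_correct _)); exists z; now split.
Qed.

Lemma norm_formula_finite (alpha : R) : 0 < alpha < 1 ->
  is_finite (norm_formula alpha).
Proof.
  intro Ha; apply (is_finite_Lub_Rbar _ (norm_integral alpha 0) (16 / alpha ^ 2)).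
  - exists 0; split; [lra|reflexivity].
  - intros x [r [Hr ->]]; rewrite norm_integral_kern by (assumption || lra).
    now apply RInt_kern_le.
Qed.

Lemma RInt_kern_le_norm_formula (alpha r : R) : 0 < alpha < 1 -> 0 <= r < 1 ->
  RInt (kern alpha r) 0 1 <= norm_formula alpha.
Proof.
  intros Ha Hr; rewrite <- norm_integral_kern by (assumption || lra).
  assert (H : Rbar_le (norm_integral alpha r) (norm_formula alpha)).
  { apply (proj1 (Lub_Rbar_correct _)); now exists r. }
  now rewrite <- (norm_formula_finite alpha Ha) in H.
Qed.

Lemma hnorm_cesaro_le (alpha : R) (a : nat -> C) : 0 < alpha < 1 -> in_Hlog alpha a ->
  is_finite (hnorm alpha (cesaro a)) /\
  hnorm alpha (cesaro a) <= hnorm alpha a * norm_formula alpha.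
Proof.
  intros Ha [Han Hf]; apply hnorm_finite; intros z Hz.
  assert (HM : forall w, in_disc w -> kweight alpha w * Cmod (psum a w) <= hnorm alpha a).
  { intros w Hw; assert (H := kweight_le_hnorm alpha a w Hw); now rewrite <- Hf in H. }
  eapply Rle_trans; [exact (kweight_cesaro_le alpha _ a z (proj1 Ha) Han Hz HM)|].
  assert (Hr : 0 <= Cmod z < 1) by (split; [apply Cmod_ge_0|exact Hz]).
  apply Rmult_le_compat_l; [|now apply RInt_kern_le_norm_formula].
  eapply Rle_trans; [|apply (HM z Hz)]; apply Rmult_le_pos; [|apply Cmod_ge_0].
  left; apply rweight_pos; [apply Ha|exact Hr].
Qed.

Lemma ext_fun_unit_ball (alpha : R) : 0 < alpha < 1 ->
  in_Hlog alpha (ext_fun alpha) /\ Rbar_le (hnorm alpha (ext_fun alpha)) 1.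
Proof.
  intro Ha; destruct (hnorm_finite alpha 1 (ext_fun alpha)) as [Hf H1].
  - intros z Hz; assert (Hr : 0 <= Cmod z < 1) by (split; [apply Cmod_ge_0|exact Hz]).
    assert (Hv := rweight_pos alpha _ (proj1 Ha) Hr).
    assert (H := Cmod_psum_ext_fun_le alpha z Ha Hz); rewrite kweight_rweight.
    replace 1 with (rweight alpha (Cmod z) * / rweight alpha (Cmod z)) by (field; lra).
    apply Rmult_le_compat_l; lra.
  - split; [split; [now apply ext_fun_analytic|exact Hf]|].
    rewrite <- Hf; exact H1.
Qed.

Lemma cesaro_opnorm_eq (alpha : R) : 0 < alpha < 1 -> cesaro_opnorm alpha = norm_formula alpha.
Proof.
  intro Ha; assert (HS := norm_formula_finite alpha Ha).
  apply Rbar_is_lub_unique; split.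
  - intros x [a [Hin [H1 ->]]].
    destruct (hnorm_cesaro_le alpha a Ha Hin) as [Hf Hle].
    rewrite <- Hf, <- HS.
    destruct Hin as [_ Hfa]; rewrite <- Hfa in H1; simpl in H1 |- *.
    (* The sign allows the hypothesis ||a|| <= 1 to be multiplied by [norm_formula]. *)
    assert (0 <= norm_formula alpha).
    { eapply Rle_trans; [|apply (RInt_kern_le_norm_formula alpha 0 Ha); lra].
      apply RInt_kern_nonneg; lra. }
    nra.
  - intros b Hb; apply (proj2 (Lub_Rbar_correct _)).
    intros x [r [Hr ->]]; rewrite norm_integral_kern by (assumption || lra).
    (* One function serves all radii: its Cesaro image, evaluated at z = r, already dominates the
       integral for that r. *)
    destruct (ext_fun_unit_ball alpha Ha) as [Hin H1].
    apply Rbar_le_trans with (hnorm alpha (cesaro (ext_fun alpha))).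
    + eapply Rbar_le_trans; [|apply (kweight_le_hnorm alpha _ (RtoC r))].
      * now apply kweight_cesaro_ext_fun_ge.
      * unfold in_disc; rewrite Cmod_R, Rabs_pos_eq; lra.
    + apply Hb; exists (ext_fun alpha); exact (conj Hin (conj H1 eq_refl)).
Qed.

Lemma norm_formula_ge (alpha : R) : 0 < alpha < 1 -> / alpha <= norm_formula alpha.
Proof.
  intro Ha; apply le_epsilon; intros eps Heps.
  (* Chosen for (1 - eta)^2 >= 1 - 2 eta >= 1 - eps alpha; the cap 1/2 keeps the radius used below
     inside (0, 1). *)
  set (eta := Rmin (1 / 2) (eps * alpha / 2)).
  assert (He1 : eta <= 1 / 2) by apply Rmin_l.
  assert (He2 : eta <= eps * alpha / 2) by apply Rmin_r.
  assert (He0 : 0 < eta) by (apply Rmin_glb_lt; nra).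
  (* For r = 1 - d one has (1 - r)^alpha = eta exactly, and d <= eta because 1/alpha >= 1 and eta <
     1. Hence (1 + r)/2 >= 1 - eta, and the lower bound becomes (1 - eta)^2 / alpha. *)
  set (d := Rpower eta (/ alpha)).
  assert (Hd0 : 0 < d) by apply exp_pos.
  assert (Hia : 1 <= / alpha) by (rewrite <- Rinv_1; apply Rinv_le_contravar; lra).
  assert (Hd : d <= eta).
  { rewrite <- (exp_ln eta) by exact He0; apply exp_le_compat.
    assert (Hl := ln_le_0 eta ltac:(lra)); nra. }
  assert (HK := RInt_kern_ge alpha (1 - d) Ha ltac:(lra)).
  assert (HS := RInt_kern_le_norm_formula alpha (1 - d) Ha ltac:(lra)).
  replace (1 - (1 - d)) with d in HK by ring.
  replace (Rpower d alpha) with eta in HK.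
  - assert (H : (1 - eta) * ((1 - eta) / alpha) <= norm_formula alpha).
    { eapply Rle_trans; [|exact HS]; eapply Rle_trans; [|exact HK].
      apply Rmult_le_compat_r; [apply Rdiv_le_0_compat|]; lra. }
    apply Rmult_le_reg_r with alpha; [lra|].
    rewrite Rinv_l by lra.
    replace ((1 - eta) * ((1 - eta) / alpha)) with ((1 - eta) * (1 - eta) * / alpha) in H
      by (field; lra).
    assert (H' : (1 - eta) * (1 - eta) <= norm_formula alpha * alpha).
    { apply Rmult_le_reg_r with (/ alpha); [lra|].
      rewrite (Rmult_assoc (norm_formula alpha)), Rinv_r, Rmult_1_r by lra; exact H. }
    nra.
  - unfold d; rewrite Rpower_mult, Rinv_l, Rpower_1 by lra; reflexivity.
Qed.

Theorem theorem5p1 (alpha : R) (Ha : 0 < alpha < 1) :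
  (forall a : nat -> C, in_Hlog alpha a -> in_Hlog alpha (cesaro a)) /\
  is_finite (cesaro_opnorm alpha) /\
  (forall r, 0 <= r < 1 ->
     ex_RInt_gen (norm_integrand alpha r) (at_point 0) (Rbar_locally p_infty)) /\
  cesaro_opnorm alpha = norm_formula alpha /\
  Rbar_le (Finite (/ alpha)) (cesaro_opnorm alpha).
Proof.
  assert (HE := cesaro_opnorm_eq alpha Ha); assert (HS := norm_formula_finite alpha Ha).
  rewrite HE; repeat split.
  - apply cesaro_analytic_disc; now destruct H.
  - now apply hnorm_cesaro_le.
  - exact HS.
  - intros r Hr; eexists; apply is_RInt_gen_norm_integrand; [apply Ha|exact Hr].
  - rewrite <- HS; exact (norm_formula_ge alpha Ha).
Qed.
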